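(* Let $M_3=\Gamma\backslash H(2,1)\times S^1$ be the compact nilmanifold with invariant coframe $f^1,\dots,f^6$ satisfying $df^1=\dots=df^5=0$, $df^6=-2f^{12}+2f^{34}$, and for $t\in\mathbb{R}\setminus\{0\}$ let $(J_t,g_t)$ be the balanced Hermitian structure on $M_3$ described in the context, with torsion $T$, Levi-Civita connection $\nabla^g_t$ and Bismut-Strominger connection $\nabla^+_t$. Let $A$ be the abelian $SU(3)$-instanton described in the context. Then: (a) $dT=\dfrac{32\pi^2t^2}{12t^4-1}\,\big(p_1(\nabla^g_t)-p_1(A)\big)$ whenever $12t^4\ne1$; (b) $dT=\dfrac{32\pi^2t^2}{32t^4-1}\,\big(p_1(\nabla^+_t)-p_1(A)\big)$ whenever $32t^4\neq1$. Thus, for every $t$ with $12t^4>1$, $(M_3,J_t,g_t,A)$ is a solution to the heterotic supersymmetry equations with non-zero flux $H=T$ and constant dilaton which satisfies the three-form Bianchi identity with some $\alpha'>0$, both for $R$ the curvature of $\nabla^g_t$ and for $R$ the curvature of $\nabla^+_t$. Moreover, the space $(M_3,g_t,J_t,A,R=R(\nabla^+_t))$ of (b) is a compact solution to the heterotic equations of motion (with the same $\alpha'$ as in the Bianchi identity).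
   Context: Notation: $f^{ij}=f^i\wedge f^j$, etc. $H(2,1)$ is the $5$-dimensional generalized Heisenberg group, $\Gamma$ a lattice in it; $H(2,1)\times\mathbb{R}$ has Lie algebra $\mathfrak{h}_3$ with a left invariant coframe $f^1,\dots,f^6$ with the structure equations stated in the claim, descending to $M_3$. The structure $(J_t,g_t)$: put $e^i=f^i$ ($1\le i\le5$), $e^6=t\,f^6$, with dual frame $E_1,\dots,E_6$. Then $g_t=\sum_i e^i\otimes e^i$, and $J_t$ acts on vectors by $JE_2=E_1$, $JE_1=-E_2$, $JE_4=E_3$, $JE_3=-E_4$, $JE_6=E_5$, $JE_5=-E_6$ (equivalently, with $(Je)(X)=-e(JX)$, $Je^1=-e^2$, $Je^3=-e^4$, $Je^5=-e^6$). The Kaehler form $F(X,Y)=g(X,JY)$ is $F=e^{12}+e^{34}+e^{56}$. For a Hermitian structure $(J,g)$: $T(X,Y,Z)=-dF(JX,JY,JZ)$; $\nabla^g$ is the Levi-Civita connection; $\nabla^+$ is defined by $g(\nabla^+_XY,Z)=g(\nabla^g_XY,Z)+\frac12T(X,Y,Z)$. Balanced means $\theta=0$, where $\theta(X)=(\delta F)(JX)$; equivalently $d*F=0$. Abelian instanton $A$: write $\omega^1=e^1+ie^2=dz_1$, $\omega^2=e^3+ie^4=dz_2$ on the Lie group. $A$ is an abelian connection ($U(1)=SO(2)$) on $M_3$ whose curvature is a real $2$-form of the shape $$\mathcal F=if\,dz_1\wedge d\bar z_1-if\,dz_2\wedge d\bar z_2+e^{i\gamma}\sqrt{\tfrac14-f^2}\,dz_1\wedge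 d\bar z_2-e^{-i\gamma}\sqrt{\tfrac14-f^2}\,dz_2\wedge d\bar z_1,$$ with real $f,\gamma$ (depending on $z_1,z_2$, $|f|\le\frac12$, $\mathcal F$ descending to $M_3$) satisfying $i\partial_{z_2}f+\partial_{z_1}(e^{-i\gamma}\sqrt{\frac14-f^2})=0$ and $i\partial_{z_1}f+\partial_{z_2}(e^{i\gamma}\sqrt{\frac14-f^2})=0$. As a connection on a real rank two bundle its curvature matrix is $\Omega^1_2=-\Omega^2_1=\mathcal F$, so $p_1(A)=\frac1{8\pi^2}\mathcal F\wedge\mathcal F$. Pontrjagin forms: for a metric connection with curvature $2$-forms $\Omega^i_j(X,Y)=g(R(X,Y)E_j,E_i)$ in an orthonormal frame, $p_1=\frac1{8\pi^2}\sum_{i<j}\Omega^i_j\wedge\Omega^i_j$. An $SU(3)$-instanton with respect to $(J,g)$ is a connection whose curvature $\Omega$ satisfies $\Omega(JX,JY)=\Omega(X,Y)$ and $\sum_{k=1}^6\Omega(E_k,JE_k)=0$ for a $g$-orthonormal frame. Heterotic supersymmetry equations with constant dilaton for $(M,J,g,A)$: (i) $Hol(\nabla^+)\subset\mathfrak{su}(3)$, i.e. $\sum_i g(R^+(X,Y)JE_i,E_i)=0$; (ii) $(J,g)$ is balanced; (iii) $A$ is an $SU(3)$-instanton. Three-form Bianchi identity: $dT=\frac{\alpha'}4\big(Tr(R\wedge R)-Tr(F^A\wedge F^A)\big)$, where $Tr(R\wedge R)=\sum_{a,b}R_{ab}\wedge R_{ab}$ over all pairs of matrix indices in an orthonormal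 frame (and similarly for the curvature $F^A$ of $A$, so $Tr(F^A\wedge F^A)=2\mathcal F\wedge\mathcal F$); with $p_1=\frac1{8\pi^2}\sum_{i<j}\Omega^i_j\wedge\Omega^i_j$, $Tr(R\wedge R)=16\pi^2p_1(R)$. Heterotic equations of motion with constant dilaton and $H=T$ (indices in orthonormal frames, $R_{imab}=g(R(E_i,E_m)E_a,E_b)$): $Ric^g_{ij}-\frac14H_{imn}H_j{}^{mn}-\frac{\alpha'}4\big[(F^A)_{imab}(F^A)_j{}^{mab}-R_{imab}R_j{}^{mab}\big]=0$; $\nabla^g_iH^i{}_{jk}=0$; $\nabla^+_i(F^A)^i{}_j=0$. Here $(F^A)_{imab}(F^A)_j{}^{mab}=2\mathcal F_{im}\mathcal F_j{}^m$. *)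

(* Defs.v *)
From HB Require Import structures.
From mathcomp Require Import all_boot all_order all_algebra.
From mathcomp Require Import generic_quotient complex.
From mathcomp Require Import all_classical all_reals all_analysis.
From mathcomp Require Import ring lra.

Set Implicit Arguments.
Unset Strict Implicit.
Unset Printing Implicit Defensive.

Import Order.TTheory GRing.Theory Num.Theory.
Import numFieldNormedType.Exports.

Local Open Scope classical_set_scope.
Local Open Scope ring_scope.

(** One-based indices of the six coordinates. *)
Definition i1 : 'I_6 := Ordinal (isT : 0 < 6)%N.
Definition i2 : 'I_6 := Ordinal (isT : 1 < 6)%N.
Definition i3 : 'I_6 := Ordinal (isT : 2 < 6)%N.
Definition i4 : 'I_6 := Ordinal (isT : 3 < 6)%N.
Definition i5 : 'I_6 := Ordinal (isT : 4 < 6)%N.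
Definition i6 : 'I_6 := Ordinal (isT : 5 < 6)%N.

Definition coord (R : realType) (x : 'rV[R]_6) (i : 'I_6) : R := x ord0 i.

(** * The groups H(2,1) and H(2,1) x R

    H(2,1) is R^5 with coordinates (x1, x2, x3, x4, x6), and H(2,1) x R is R^6,
    the fifth coordinate being that of the factor R.  The cocycle
    2 (a1 x2 - a3 x4) is the one for which the coframe
      f^i = dx_i (i <= 5),   f^6 = dx_6 - 2 x1 dx_2 + 2 x3 dx_4,
    with df^6 = - 2 f^12 + 2 f^34, is left invariant; the unit is 0. *)

Definition h1 : 'I_5 := Ordinal (isT : 0 < 5)%N.
Definition h2 : 'I_5 := Ordinal (isT : 1 < 5)%N.
Definition h3 : 'I_5 := Ordinal (isT : 2 < 5)%N.
Definition h4 : 'I_5 := Ordinal (isT : 3 < 5)%N.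
Definition h5 : 'I_5 := Ordinal (isT : 4 < 5)%N.

Definition heis_mul (R : realType) (a y : 'rV[R]_5) : 'rV[R]_5 :=
  a + y + (2 * a ord0 h1 * y ord0 h2 - 2 * a ord0 h3 * y ord0 h4)
            *: delta_mx ord0 h5.

Definition heis_inv (R : realType) (a : 'rV[R]_5) : 'rV[R]_5 :=
  - a + (2 * a ord0 h1 * a ord0 h2 - 2 * a ord0 h3 * a ord0 h4)
            *: delta_mx ord0 h5.

Definition grp_mul (R : realType) (a x : 'rV[R]_6) : 'rV[R]_6 :=
  a + x + (2 * coord a i1 * coord x i2 - 2 * coord a i3 * coord x i4)
            *: delta_mx ord0 i6.

Definition grp_inv (R : realType) (a : 'rV[R]_6) : 'rV[R]_6 :=
  - a + (2 * coord a i1 * coord a i2 - 2 * coord a i3 * coord a i4)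
            *: delta_mx ord0 i6.

Definition heis_part (R : realType) (x : 'rV[R]_6) : 'rV[R]_5 := col' i5 x.

(** A lattice: a discrete subgroup with compact quotient. *)
Record heis_lattice (R : realType) := HeisLattice {
  lat :> set 'rV[R]_5;
  lat_unit : lat 0;
  lat_mul : forall a b, lat a -> lat b -> lat (heis_mul a b);
  lat_inv : forall a, lat a -> lat (heis_inv a);
  lat_discrete : \forall a \near (0 : 'rV[R]_5), lat a -> a = 0;
  lat_cocompact : exists2 K : set 'rV[R]_5, compact K &
    forall y, exists a k, [/\ lat a, K k & y = heis_mul a k] }.

(** The deck transformation group Gamma x (ell Z) of
    M_3 = Gamma \ H(2,1) x S^1, where S^1 = R / ell Z. *)
Definition deck (R : realType) (Gam : heis_lattice R) (ell : R) :
    set 'rV[R]_6 :=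
  [set a | lat Gam (heis_part a) /\ exists k : int, coord a i5 = ell * k%:~R].

Definition deck_rel (R : realType) (Gam : heis_lattice R) (ell : R) :
    rel 'rV[R]_6 :=
  fun x y => `[< exists2 a, deck Gam ell a & y = grp_mul a x >].

Lemma ord6P (P : 'I_6 -> Prop) :
  P i1 -> P i2 -> P i3 -> P i4 -> P i5 -> P i6 -> forall i, P i.
Proof.
move=> p1 p2 p3 p4 p5 p6 [[|[|[|[|[|[|//]]]]]] lt_i];
  by rewrite (bool_irrelevance lt_i isT).
Qed.

Lemma big_ord6 (R : nmodType) (F : 'I_6 -> R) :
  \sum_i F i = F i1 + (F i2 + (F i3 + (F i4 + (F i5 + F i6)))).
Proof.
do ![rewrite big_ord_recl] => /=; rewrite big_ord0 addr0.
by do ![congr (_ + _)]; congr F; exact/val_inj.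
Qed.

Lemma grp_mulA (R : realType) (a b x : 'rV[R]_6) :
  grp_mul a (grp_mul b x) = grp_mul (grp_mul a b) x.
Proof.
by apply/rowP; apply: ord6P; rewrite /grp_mul /coord !mxE /=; ring.
Qed.

Lemma grp_mul0 (R : realType) (x : 'rV[R]_6) : grp_mul 0 x = x.
Proof.
by apply/rowP; apply: ord6P; rewrite /grp_mul /coord !mxE /=; ring.
Qed.

Lemma grp_mulV (R : realType) (a : 'rV[R]_6) : grp_mul (grp_inv a) a = 0.
Proof.
by apply/rowP; apply: ord6P; rewrite /grp_mul /grp_inv /coord !mxE /=; ring.
Qed.

Lemma heis_partE (R : realType) (x : 'rV[R]_6) :
  [/\ heis_part x ord0 h1 = coord x i1, heis_part x ord0 h2 = coord x i2,
      heis_part x ord0 h3 = coord x i3, heis_part x ord0 h4 = coord x i4 &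
      heis_part x ord0 h5 = coord x i6].
Proof. by split; rewrite mxE; congr (x _ _); exact/val_inj. Qed.

Lemma heis_rowP (R : realType) (y z : 'rV[R]_5) :
  y ord0 h1 = z ord0 h1 -> y ord0 h2 = z ord0 h2 -> y ord0 h3 = z ord0 h3 ->
  y ord0 h4 = z ord0 h4 -> y ord0 h5 = z ord0 h5 -> y = z.
Proof.
move=> e1 e2 e3 e4 e5; apply/rowP => -[[|[|[|[|[|//]]]]] lt_i];
  by rewrite (bool_irrelevance lt_i isT).
Qed.

Lemma heis_partM (R : realType) (a b : 'rV[R]_6) :
  heis_part (grp_mul a b) = heis_mul (heis_part a) (heis_part b).
Proof.
have [m1 m2 m3 m4 m5] := heis_partE (grp_mul a b).
have [a1 a2 a3 a4 a5] := heis_partE a; have [b1 b2 b3 b4 b5] := heis_partE b.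
apply: heis_rowP; rewrite ?m1 ?m2 ?m3 ?m4 ?m5 ![heis_mul _ _ _ _]mxE
  [(heis_part a + heis_part b) _ _]mxE ?a1 ?a2 ?a3 ?a4 ?a5 ?b1 ?b2 ?b3 ?b4 ?b5;
  by rewrite /grp_mul /coord !mxE /=; ring.
Qed.

Lemma heis_partV (R : realType) (a : 'rV[R]_6) :
  heis_part (grp_inv a) = heis_inv (heis_part a).
Proof.
have [m1 m2 m3 m4 m5] := heis_partE (grp_inv a).
have [a1 a2 a3 a4 a5] := heis_partE a.
apply: heis_rowP; rewrite ?m1 ?m2 ?m3 ?m4 ?m5 ![heis_inv _ _ _]mxE
  [(- heis_part a) _ _]mxE ?a1 ?a2 ?a3 ?a4 ?a5;
  by rewrite /grp_inv /coord !mxE /=; ring.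
Qed.

Lemma deck_relP (R : realType) (Gam : heis_lattice R) (ell : R) :
  equiv_class_of (deck_rel Gam ell).
Proof.
split.
- move=> x; apply/asboolP; exists 0; last by rewrite grp_mul0.
  split; last by exists 0; rewrite /coord mxE mulr0.
  suff -> : heis_part (0 : 'rV[R]_6) = 0 by exact: lat_unit.
  by apply/rowP => i; rewrite !mxE.
- have sym x y : deck_rel Gam ell x y -> deck_rel Gam ell y x.
    move=> /asboolP[a [lata [k ak]] ->]; apply/asboolP.
    exists (grp_inv a); last by rewrite grp_mulA grp_mulV grp_mul0.
    split; first by rewrite heis_partV; exact: lat_inv.
    by exists (- k); rewrite mulrNz mulrN -ak /grp_inv /coord !mxE /=; ring.
  by move=> x y; apply/idP/idP; exact: sym.
- move=> y x z /asboolP[a [lata [k ak]] ->] /asboolP[b [latb [l bl]] ->].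
  apply/asboolP; exists (grp_mul b a); last by rewrite grp_mulA.
  split; first by rewrite heis_partM; exact: lat_mul.
  exists (l + k); rewrite intrD mulrDr -ak -bl /grp_mul /coord !mxE /=; ring.
Qed.

Canonical deck_equiv (R : realType) (Gam : heis_lattice R) (ell : R) :=
  EquivRelPack (deck_relP Gam ell).

(** The nilmanifold M_3 as a topological space.  Tensors on M_3 are handled
    below as tensors on R^6 invariant under the deck transformations. *)
Definition M3 (R : realType) (Gam : heis_lattice R) (ell : R) : topologicalType :=
  quotient_topology {eq_quot (deck_equiv Gam ell)}%qT.

(** * Tensor calculus on R^6

    Tangent vectors are identified with row vectors by means of the global
    chart.  A k-form is a function of a point and k vectors; the arguments of
    the forms below are always multilinear.  Since vectors extend to constant,
    hence commuting, vector fields, no bracket terms appear in [d1], [d2], [d3]. *)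

Definition vfield (R : realType) := 'rV[R]_6 -> 'rV[R]_6.
Definition form1 (R : realType) := 'rV[R]_6 -> 'rV[R]_6 -> R.
Definition form2 (R : realType) := 'rV[R]_6 -> 'rV[R]_6 -> 'rV[R]_6 -> R.
Definition form3 (R : realType) :=
  'rV[R]_6 -> 'rV[R]_6 -> 'rV[R]_6 -> 'rV[R]_6 -> R.
Definition form4 (R : realType) :=
  'rV[R]_6 -> 'rV[R]_6 -> 'rV[R]_6 -> 'rV[R]_6 -> 'rV[R]_6 -> R.

Definition d1 (R : realType) (w : form1 R) : form2 R := fun x u0 u1 =>
  'D_u0 (fun y => w y u1) x - 'D_u1 (fun y => w y u0) x.

Definition d2 (R : realType) (w : form2 R) : form3 R := fun x u0 u1 u2 =>
  'D_u0 (fun y => w y u1 u2) x - 'D_u1 (fun y => w y u0 u2) x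
  + 'D_u2 (fun y => w y u0 u1) x.

Definition d3 (R : realType) (w : form3 R) : form4 R := fun x u0 u1 u2 u3 =>
  'D_u0 (fun y => w y u1 u2 u3) x - 'D_u1 (fun y => w y u0 u2 u3) x
  + 'D_u2 (fun y => w y u0 u1 u3) x - 'D_u3 (fun y => w y u0 u1 u2) x.

Definition wedge11 (R : realType) (a b : form1 R) : form2 R := fun x u v =>
  a x u * b x v - a x v * b x u.

Definition wedge22 (R : realType) (a b : form2 R) : form4 R :=
  fun x u0 u1 u2 u3 =>
    a x u0 u1 * b x u2 u3 - a x u0 u2 * b x u1 u3 + a x u0 u3 * b x u1 u2
  + a x u1 u2 * b x u0 u3 - a x u1 u3 * b x u0 u2 + a x u2 u3 * b x u0 u1.

Definition bracket (R : realType) (X Y : vfield R) : vfield R := fun x =>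
  'D_(X x) Y x - 'D_(Y x) X x.

(** C^infinity: all iterated directional derivatives are differentiable. *)
Definition smooth (R : realType) (h : 'rV[R]_6 -> R) : Prop :=
  forall (vs : seq 'rV[R]_6) (x : 'rV[R]_6),
    differentiable (foldr (fun v k => 'D_v k) h vs) x.

(** An affine connection, as the operator (X, Y) |-> nabla_X Y. *)
Definition connection (R : realType) := vfield R -> vfield R -> vfield R.

Definition curvature (R : realType) (nabla : connection R) (X Y Z : vfield R) :
    vfield R := fun x =>
  nabla X (nabla Y Z) x - nabla Y (nabla X Z) x - nabla (bracket X Y) Z x.

(** (nabla_X w)(Y, Z) and (nabla_X w)(Y, Z, W). *)
Definition cov2 (R : realType) (nabla : connection R) (w : form2 R)
    (X Y Z : vfield R) (x : 'rV[R]_6) : R :=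
  'D_(X x) (fun y => w y (Y y) (Z y)) x
  - w x (nabla X Y x) (Z x) - w x (Y x) (nabla X Z x).

Definition cov3 (R : realType) (nabla : connection R) (w : form3 R)
    (X Y Z W : vfield R) (x : 'rV[R]_6) : R :=
  'D_(X x) (fun y => w y (Y y) (Z y) (W y)) x
  - w x (nabla X Y x) (Z x) (W x) - w x (Y x) (nabla X Z x) (W x)
  - w x (Y x) (Z x) (nabla X W x).

(** * Hermitian geometry *)

(** [frame] is meant to be orthonormal for [metric]; see [hermitian]. *)
Record hermitian_data (R : realType) := HermitianData {
  metric : form2 R;
  cplx : 'rV[R]_6 -> 'rV[R]_6 -> 'rV[R]_6;
  frame : 'I_6 -> vfield R }.

(** The Nijenhuis tensor; [u] and [v] are extended as constant vector fields. *)
Definition nijenhuis (R : realType) (J : 'rV[R]_6 -> 'rV[R]_6 -> 'rV[R]_6)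
    (x u v : 'rV[R]_6) : 'rV[R]_6 :=
  bracket (J^~ u) (J^~ v) x - J x (bracket (J^~ u) (cst v) x)
  - J x (bracket (cst u) (J^~ v) x) - bracket (cst u) (cst v) x.

Definition hermitian (R : realType) (S : hermitian_data R) : Prop :=
  [/\ forall x i j, metric S x (frame S i x) (frame S j x) = (i == j)%:R,
      forall x u, cplx S x (cplx S x u) = - u,
      forall x u v, metric S x (cplx S x u) (cplx S x v) = metric S x u v &
      forall x u v, nijenhuis (cplx S) x u v = 0].

Definition kaehler (R : realType) (S : hermitian_data R) : form2 R :=
  fun x u v => metric S x u (cplx S x v).

Definition torsion (R : realType) (S : hermitian_data R) : form3 R :=
  fun x u v w =>
    - d2 (kaehler S) x (cplx S x u) (cplx S x v) (cplx S x w).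

(** Koszul's formula for the constant vector fields [u] and [v], solved for
    nabla_u v by means of the orthonormal frame, the vector fields [E_k]
    being frozen at [x]. *)
Definition christoffel (R : realType) (S : hermitian_data R)
    (x u v : 'rV[R]_6) : 'rV[R]_6 :=
  let g := metric S in
  \sum_(k < 6) (2^-1 * ('D_u (fun y => g y v (frame S k x)) x
                        + 'D_v (fun y => g y u (frame S k x)) x
                        - 'D_(frame S k x) (fun y => g y u v) x))
               *: frame S k x.

Definition levi_civita (R : realType) (S : hermitian_data R) : connection R :=
  fun X Y x => 'D_(X x) Y x + christoffel S x (X x) (Y x).

(** The Bismut-Strominger connection
    g(nabla^+_X Y, Z) = g(nabla^g_X Y, Z) + T(X, Y, Z) / 2. *)
Definition bismut (R : realType) (S : hermitian_data R) : connection R :=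
  fun X Y x => levi_civita S X Y x
    + \sum_(k < 6) (2^-1 * torsion S x (X x) (Y x) (frame S k x))
                   *: frame S k x.

(** Matrix of curvature 2-forms Omega^i_j(u, v) = g(R(u, v) E_j, E_i). *)
Definition curv_form (R : realType) (S : hermitian_data R)
    (nabla : connection R) (i j : 'I_6) : form2 R :=
  fun x u v => metric S x (curvature nabla (cst u) (cst v) (frame S j) x)
                          (frame S i x).

Definition codiff_kaehler (R : realType) (S : hermitian_data R) : form1 R :=
  fun x u => - \sum_(i < 6)
    cov2 (levi_civita S) (kaehler S) (frame S i) (frame S i) (cst u) x.

Definition lee_form (R : realType) (S : hermitian_data R) : form1 R :=
  fun x u => codiff_kaehler S x (cplx S x u).

Definition balanced (R : realType) (S : hermitian_data R) : Prop :=
  forall x u, lee_form S x u = 0.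

(** The condition Hol(nabla^+) < su(3), expressed on the curvature. *)
Definition su3_holonomy (R : realType) (S : hermitian_data R) : Prop :=
  forall x u v, \sum_(i < 6)
    metric S x (curvature (bismut S) (cst u) (cst v)
                  (fun y => cplx S y (frame S i y)) x) (frame S i x) = 0.

Definition su3_instanton (R : realType) (S : hermitian_data R) (n : nat)
    (Om : 'I_n -> 'I_n -> form2 R) : Prop :=
  forall a b x,
    (forall u v, Om a b x (cplx S x u) (cplx S x v) = Om a b x u v) /\
    \sum_(k < 6) Om a b x (frame S k x) (cplx S x (frame S k x)) = 0.

Definition pontrjagin (R : realType) (n : nat) (Om : 'I_n -> 'I_n -> form2 R) :
    form4 R := fun x u0 u1 u2 u3 =>
  (8 * pi ^+ 2)^-1 * \sum_(i < n) \sum_(j < n | (i < j)%N)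
    wedge22 (Om i j) (Om i j) x u0 u1 u2 u3.

(** Tr(Omega /\ Omega), with the sign convention sum_{a, b} Omega_ab^2. *)
Definition trace_sq (R : realType) (n : nat) (Om : 'I_n -> 'I_n -> form2 R) :
    form4 R := fun x u0 u1 u2 u3 =>
  \sum_(a < n) \sum_(b < n) wedge22 (Om a b) (Om a b) x u0 u1 u2 u3.

(** * The heterotic system with constant dilaton and flux H = T *)

Definition heterotic_susy (R : realType) (S : hermitian_data R) (n : nat)
    (OmA : 'I_n -> 'I_n -> form2 R) : Prop :=
  [/\ hermitian S, su3_holonomy S, balanced S & su3_instanton S OmA].

Definition nonzero_flux (R : realType) (S : hermitian_data R) : Prop :=
  exists x u v w, torsion S x u v w != 0.

Definition bianchi (R : realType) (S : hermitian_data R)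
    (nabla : connection R) (n : nat) (OmA : 'I_n -> 'I_n -> form2 R)
    (alpha : R) : Prop :=
  forall x u0 u1 u2 u3, d3 (torsion S) x u0 u1 u2 u3
    = alpha / 4 * (trace_sq (curv_form S nabla) x u0 u1 u2 u3
                   - trace_sq OmA x u0 u1 u2 u3).

Definition ricci (R : realType) (S : hermitian_data R) (i j : 'I_6)
    (x : 'rV[R]_6) : R :=
  \sum_(k < 6) metric S x
    (curvature (levi_civita S) (frame S k) (frame S i) (frame S j) x)
    (frame S k x).

(** sum over m, a, b of Omega_imab Omega_jmab, where
    Omega_imab = Omega^b_a(E_i, E_m). *)
Definition curv_sq (R : realType) (S : hermitian_data R) (n : nat)
    (Om : 'I_n -> 'I_n -> form2 R) (i j : 'I_6) (x : 'rV[R]_6) : R :=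
  \sum_(m < 6) \sum_(a < n) \sum_(b < n)
    Om b a x (frame S i x) (frame S m x) * Om b a x (frame S j x) (frame S m x).

Definition flux_sq (R : realType) (S : hermitian_data R) (i j : 'I_6)
    (x : 'rV[R]_6) : R :=
  let H k l m := torsion S x (frame S k x) (frame S l x) (frame S m x) in
  \sum_(m < 6) \sum_(n < 6) H i m n * H j m n.

(** [nabla] is the connection whose curvature is the R of the equations.  The
    equation for [OmA] involves no gauge connection term, because [OmA] is
    only used for abelian connections. *)
Definition heterotic_eom (R : realType) (S : hermitian_data R)
    (nabla : connection R) (n : nat) (OmA : 'I_n -> 'I_n -> form2 R)
    (alpha : R) : Prop :=
  [/\ forall i j x, ricci S i j x - 4^-1 * flux_sq S i j x
        - alpha / 4 * (curv_sq S OmA i j x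
                       - curv_sq S (curv_form S nabla) i j x) = 0,
      forall j k x, \sum_(i < 6) cov3 (levi_civita S) (torsion S)
        (frame S i) (frame S i) (frame S j) (frame S k) x = 0 &
      forall a b j x, \sum_(i < 6) cov2 (bismut S) (OmA a b)
        (frame S i) (frame S i) (frame S j) x = 0].

(** * The structures (J_t, g_t) *)

Definition coframe_f (R : realType) (i : 'I_6) : form1 R := fun x u =>
  if i == i6 then coord u i6 - 2 * coord x i1 * coord u i2
                  + 2 * coord x i3 * coord u i4
  else coord u i.

Definition coframe (R : realType) (t : R) (i : 'I_6) : form1 R := fun x u =>
  (if i == i6 then t else 1) * coframe_f i x u.

(** The frame dual to [coframe t]. *)
Definition dual_frame (R : realType) (t : R) (i : 'I_6) : vfield R := fun x =>
  if i == i6 then t^-1 *: delta_mx ord0 i6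
  else delta_mx ord0 i
       + (2 * coord x i1 * (i == i2)%:R - 2 * coord x i3 * (i == i4)%:R)
           *: delta_mx ord0 i6.

Definition metric_t (R : realType) (t : R) : form2 R := fun x u v =>
  \sum_(i < 6) coframe t i x u * coframe t i x v.

(** J E_1 = - E_2, J E_2 = E_1, and so on. *)
Definition cplx_t (R : realType) (t : R) (x u : 'rV[R]_6) : 'rV[R]_6 :=
    coframe t i2 x u *: dual_frame t i1 x - coframe t i1 x u *: dual_frame t i2 x
  + coframe t i4 x u *: dual_frame t i3 x - coframe t i3 x u *: dual_frame t i4 x
  + coframe t i6 x u *: dual_frame t i5 x - coframe t i5 x u *: dual_frame t i6 x.

Definition structure_t (R : realType) (t : R) : hermitian_data R :=
  HermitianData (metric_t t) (cplx_t t) (dual_frame t).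

(** * Abelian connections on M_3 *)

(** A U(1)-bundle with connection over the quotient of R^6 by [L].  Its
    pull-back to R^6 is trivial, so it is given by a connection form [pot] on
    R^6 together with an action of [L] on R^6 x U(1) of the form
      l (x, e^(i theta)) = (l x, e^(i (theta + cocyc l x))).
    [pot_equivariant] says l^* pot = pot + d (cocyc l). *)
Record u1_connection (R : realType) (L : set 'rV[R]_6) := U1Connection {
  pot : form1 R;
  cocyc : 'rV[R]_6 -> 'rV[R]_6 -> R;
  pot_linear : forall x (a : R) u v,
    pot x (a *: u + v) = a * pot x u + pot x v;
  pot_smooth : forall u, smooth (fun x => pot x u);
  cocyc_smooth : forall l, L l -> smooth (cocyc l);
  pot_equivariant : forall l, L l -> forall x u,
    pot (grp_mul l x) ('D_u (grp_mul l) x) = pot x u + 'D_u (cocyc l) x;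
  cocycP : forall l m, L l -> L m -> forall x, exists k : int,
    cocyc (grp_mul l m) x = cocyc l (grp_mul m x) + cocyc m x
                            + 2 * pi * k%:~R }.

Definition u1_curvature (R : realType) (L : set 'rV[R]_6)
    (A : u1_connection L) : form2 R := d1 (pot A).

(** The curvature matrix of the associated real rank two bundle:
    Omega^1_2 = - Omega^2_1 is the curvature of [A]. *)
Definition so2_curvature (R : realType) (L : set 'rV[R]_6)
    (A : u1_connection L) (a b : 'I_2) : form2 R := fun x u v =>
  if (a < b)%N then u1_curvature A x u v
  else if (b < a)%N then - u1_curvature A x u v else 0.

Definition z1 (R : realType) (x : 'rV[R]_6) : R[i] :=
  Complex (coord x i1) (coord x i2).
Definition z2 (R : realType) (x : 'rV[R]_6) : R[i] :=
  Complex (coord x i3) (coord x i4).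

(** The complex 1-forms dz_1 = f^1 + i f^2 and dz_2 = f^3 + i f^4. *)
Definition dz1 (R : realType) (x u : 'rV[R]_6) : R[i] :=
  Complex (coframe_f i1 x u) (coframe_f i2 x u).
Definition dz2 (R : realType) (x u : 'rV[R]_6) : R[i] :=
  Complex (coframe_f i3 x u) (coframe_f i4 x u).

Definition conj_form (R : realType) (a : 'rV[R]_6 -> 'rV[R]_6 -> R[i])
    (x u : 'rV[R]_6) : R[i] := conjc (a x u).

Definition cwedge (R : realType) (a b : 'rV[R]_6 -> 'rV[R]_6 -> R[i])
    (x u v : 'rV[R]_6) : R[i] := a x u * b x v - a x v * b x u.

Definition cderive (R : realType) (v : 'rV[R]_6) (phi : 'rV[R]_6 -> R[i])
    (x : 'rV[R]_6) : R[i] :=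
  Complex ('D_v (fun y => complex.Re (phi y)) x)
          ('D_v (fun y => complex.Im (phi y)) x).

(** d/dz_1 and d/dz_2, for functions on R^6 that factor through (z_1, z_2). *)
Definition d_z1 (R : realType) (phi : 'rV[R]_6 -> R[i]) (x : 'rV[R]_6) : R[i] :=
  2^-1 * (cderive (delta_mx ord0 i1) phi x
          - Complex 0 1 * cderive (delta_mx ord0 i2) phi x).
Definition d_z2 (R : realType) (phi : 'rV[R]_6 -> R[i]) (x : 'rV[R]_6) : R[i] :=
  2^-1 * (cderive (delta_mx ord0 i3) phi x
          - Complex 0 1 * cderive (delta_mx ord0 i4) phi x).

(** e^(i a) *)
Definition expi (R : realType) (a : R) : R[i] := Complex (cos a) (sin a).

(** The coefficient e^(i gamma) sqrt(1/4 - f^2), where [gamma] may be replaced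
    by [- gamma]. *)
Definition inst_coef (R : realType) (f gamma : R) : R[i] :=
  expi gamma * Complex (Num.sqrt (4^-1 - f ^+ 2)) 0.

(** [f] and [gamma] are functions of (z_1, z_2).  That the curvature is smooth
    and invariant under [L] follows from the axioms on [A]; [gamma] itself is
    only meaningful where |f| < 1/2. *)
Definition abelian_instanton (R : realType) (L : set 'rV[R]_6)
    (A : u1_connection L) (f gamma : R[i] -> R[i] -> R) : Prop :=
  let F x := f (z1 x) (z2 x) in
  let G x := gamma (z1 x) (z2 x) in
  [/\ forall x, `|F x| <= 2^-1,
      forall x u v, Complex (u1_curvature A x u v) 0
        = Complex 0 (F x) * cwedge (@dz1 R) (conj_form (@dz1 R)) x u v
        - Complex 0 (F x) * cwedge (@dz2 R) (conj_form (@dz2 R)) x u v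
        + inst_coef (F x) (G x) * cwedge (@dz1 R) (conj_form (@dz2 R)) x u v
        - inst_coef (F x) (- G x) * cwedge (@dz2 R) (conj_form (@dz1 R)) x u v,
      forall x, Complex 0 1 * d_z2 (fun y => Complex (F y) 0) x
        + d_z1 (fun y => inst_coef (F y) (- G y)) x = 0 &
      forall x, Complex 0 1 * d_z1 (fun y => Complex (F y) 0) x
        + d_z2 (fun y => inst_coef (F y) (G y)) x = 0].

(** * Consistency of the model *)

Lemma derive_affine (R : realType) (W : normedModType R) (h : 'rV[R]_6 -> W)
    (x u : 'rV[R]_6) (l : W) :
  (forall s : R, h (s *: u + x) = s *: l + h x) -> is_derive x u h l.
Proof.
move=> hE; suff cvg_l : s^-1 *: ((h \o shift x) (s *: u) - h x) @[s --> 0^'] --> l.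
  by apply: DeriveDef; [apply/cvg_ex; exists l | exact/cvg_lim].
apply: cvg_near_cst; near=> s.
rewrite /= hE addrK scalerA mulVf ?scale1r //; near: s; exact: nbhs_dnbhs_neq.
Unshelve. all: by end_near. Qed.

Lemma coframe_dual (R : realType) (t : R) (x : 'rV[R]_6) (i j : 'I_6) :
  t != 0 -> coframe t i x (dual_frame t j x) = (i == j)%:R.
Proof.
move=> t0; move: i j; apply: ord6P; apply: ord6P;
  by rewrite /coframe /coframe_f /dual_frame /coord /= !mxE /=; field.
Qed.

Lemma coframe_f_left_invariant (R : realType) (a x u : 'rV[R]_6) (i : 'I_6) :
  coframe_f i (grp_mul a x) ('D_u (grp_mul a) x) = coframe_f i x u.
Proof.
have D : is_derive x u (grp_mul a) (u + (2 * coord a i1 * coord u i2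
    - 2 * coord a i3 * coord u i4) *: delta_mx ord0 i6).
  apply: derive_affine => s; apply/rowP; apply: ord6P;
    by rewrite /grp_mul /coord !mxE /=; ring.
rewrite derive_val; move: i; apply: ord6P;
  by rewrite /coframe_f /grp_mul /coord /= !mxE /=; ring.
Qed.

Lemma is_derive_coframe_f (R : realType) (x u v : 'rV[R]_6) (i : 'I_6) :
  is_derive x u (fun y => coframe_f i y v)
    ((i == i6)%:R * (- 2 * coord u i1 * coord v i2
                     + 2 * coord u i3 * coord v i4)).
Proof.
apply: derive_affine => s; move: i; apply: ord6P;
  by rewrite /coframe_f /coord /= ?mxE /GRing.scale /=; ring.
Qed.

Lemma d1_coframe_f (R : realType) (x u v : 'rV[R]_6) (i : 'I_6) :
  d1 (@coframe_f R i) x u v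
  = if i == i6 then - 2 * wedge11 (@coframe_f R i1) (@coframe_f R i2) x u v
                    + 2 * wedge11 (@coframe_f R i3) (@coframe_f R i4) x u v
    else 0.
Proof.
have D u' v' := is_derive_coframe_f x u' v' i.
rewrite /d1 !derive_val; case: ifP => _; rewrite /wedge11 /coframe_f /=; ring.
Qed.

Lemma frame_decomp (R : realType) (t : R) (x u : 'rV[R]_6) : t != 0 ->
  u = \sum_(k < 6) coframe t k x u *: dual_frame t k x.
Proof.
move=> t0; rewrite big_ord6; apply/rowP; apply: ord6P;
  by rewrite /coframe /coframe_f /dual_frame /coord /= !mxE /=; field.
Qed.

Lemma coframe_sum (R : realType) (t : R) (t0 : t != 0) (x : 'rV[R]_6)
    (k : 'I_6) (c : 'I_6 -> R) :
  coframe t k x (\sum_(i < 6) c i *: dual_frame t i x) = c k.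
Proof.
have lin (e : 'I_6 -> 'rV[R]_6) :
    coframe t k x (\sum_i c i *: e i) = \sum_i c i * coframe t k x (e i).
  by rewrite !big_ord6 /coframe /coframe_f /coord /= !mxE; case: (k == i6); ring.
rewrite lin; under eq_bigr do rewrite (coframe_dual _ _ _ t0).
rewrite (bigD1 k) //= eqxx mulr1 big1 ?addr0 // => j /negPf jk.
by rewrite eq_sym jk mulr0.
Qed.

Lemma kaehler_t (R : realType) (t : R) (x u v : 'rV[R]_6) : t != 0 ->
  kaehler (structure_t t) x u v
  = wedge11 (coframe t i1) (coframe t i2) x u v
  + wedge11 (coframe t i3) (coframe t i4) x u v
  + wedge11 (coframe t i5) (coframe t i6) x u v.
Proof.
move=> t0; rewrite /kaehler /= /metric_t big_ord6 /wedge11.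
rewrite /cplx_t /coframe /coframe_f /dual_frame /coord /= !mxE /=; field.
exact: t0.
Qed.

Lemma derive_aux (R : realType) (p q : 'rV[R]_6 -> R) (c k dp dq : R)
    (x u : 'rV[R]_6) : is_derive x u p dp -> is_derive x u q dq ->
  'D_u (cst c + k *: (p * q))%R x = k * (dp * q x + p x * dq).
Proof. 
move=> Dp Dq.
have := is_deriveD (is_derive_cst c x u) (is_deriveZ k (is_deriveM Dp Dq)).
move=> /@derive_val -> ; rewrite add0r /GRing.scale /= addrC.
by rewrite (mulrC (q x)). Qed.

Lemma derive_metric_t (R : realType) (t : R) (x u v w : 'rV[R]_6) :
  'D_u (fun y => metric_t t y v w) x
  = t ^+ 2 * ((- 2 * coord u i1 * coord v i2 + 2 * coord u i3 * coord v i4)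
                 * coframe_f i6 x w
            + coframe_f i6 x v
              * (- 2 * coord u i1 * coord w i2 + 2 * coord u i3 * coord w i4)).
Proof.
have Dv := is_derive_coframe_f x u v i6; have Dw := is_derive_coframe_f x u w i6.
pose c := coord v i1 * coord w i1 + coord v i2 * coord w i2
  + coord v i3 * coord w i3 + coord v i4 * coord w i4 + coord v i5 * coord w i5.
have -> : (fun y => metric_t t y v w) =
    (cst c + (t ^+ 2) *: ((fun y => coframe_f i6 y v) * (fun y => coframe_f i6 y w)))%R.
  apply/funext => y; rewrite /metric_t big_ord6 /= /c /coframe /coframe_f /=.
  by rewrite !fctE /= /GRing.scale /=; ring.
rewrite (derive_aux _ _ Dv Dw) /= !mul1r; ring.
Qed.

(** [levi_civita] is torsion free and metric. *)
Lemma levi_civita_torsion_free (R : realType) (t : R) (X Y : vfield R) x :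
  levi_civita (structure_t t) X Y x - levi_civita (structure_t t) Y X x
  = bracket X Y x.
Proof.
rewrite /levi_civita.
set S := structure_t t.
have gC a b : (fun y => metric S y a b) = (fun y => metric S y b a).
  by apply/funext => y; apply: eq_bigr => i _; rewrite mulrC.
have -> : christoffel S x (X x) (Y x) = christoffel S x (Y x) (X x).
  rewrite /christoffel; apply: eq_bigr => k _; rewrite (gC (X x) (Y x)).
  by rewrite (addrC ('D_(X x) _ x)).
by rewrite opprD addrACA subrr addr0.
Qed.

Lemma linear_sum (R : realType) (l : 'rV[R]_6 -> R)
    (l_lin : forall c p q, l (c *: p + q) = c * l p + l q)
    (c : 'I_6 -> R) (e : 'I_6 -> 'rV[R]_6) :
  l (\sum_i c i *: e i) = \sum_i c i * l (e i).
Proof.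
have l0 : l 0 = 0 by have := l_lin 1 0 0; rewrite scaler0 addr0 mul1r; lra.
have lD p q : l (p + q) = l p + l q by rewrite -{1}(scale1r p) l_lin mul1r.
rewrite (big_morph l lD l0); apply: eq_bigr => i _.
by rewrite -(addr0 (_ *: _)) l_lin l0 addr0.
Qed.

Lemma levi_civita_metric (R : realType) (t : R) (x u v w : 'rV[R]_6) :
  t != 0 -> let S := structure_t t in
  'D_w (fun y => metric S y u v) x
  = metric S x (levi_civita S (cst w) (cst u) x) v
  + metric S x u (levi_civita S (cst w) (cst v) x).
Proof.
move=> t0 S; rewrite /levi_civita !derive_cst !add0r.
change ('D_w (fun y => metric S y u v) x
  = metric S x (christoffel S x w u) v + metric S x u (christoffel S x w v)).
have gE a b : metric S x (christoffel S x w a) b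
    = 2^-1 * ('D_w (fun y => metric S y a b) x
        + 'D_a (fun y => metric S y w b) x - 'D_b (fun y => metric S y w a) x).
  have -> : metric S x (christoffel S x w a) b
    = \sum_(k < 6) coframe t k x (christoffel S x w a) * coframe t k x b by [].
  have cE k : coframe t k x (christoffel S x w a) = 2^-1 *
     ('D_w (fun y => metric S y a (dual_frame t k x)) x
      + 'D_a (fun y => metric S y w (dual_frame t k x)) x
      - 'D_(dual_frame t k x) (fun y => metric S y w a) x).
    by rewrite /christoffel (coframe_sum t0 x k
      (fun k => 2^-1 * ('D_w (fun y => metric S y a (dual_frame t k x)) x
      + 'D_a (fun y => metric S y w (dual_frame t k x)) x
      - 'D_(dual_frame t k x) (fun y => metric S y w a) x))).
  rewrite (eq_bigr _ (fun k _ => congr1 (fun z => z * _) (cE k))).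
  pose l b' := 2^-1 * ('D_w (fun y => metric S y a b') x
    + 'D_a (fun y => metric S y w b') x - 'D_b' (fun y => metric S y w a) x).
  have l_lin c p q : l (c *: p + q) = c * l p + l q.
    rewrite /l /= !derive_metric_t /coframe_f /coord /= !mxE; ring.
  have l_sum := linear_sum l_lin.
  have lb : l b = \sum_k l (dual_frame t k x) * coframe t k x b.
    apply: etrans (congr1 l (frame_decomp x b t0)) _.
    apply: etrans (l_sum _ _) _.
    by apply: eq_bigr => k _; exact: mulrC.
  exact: esym lb.
have gC : forall y a b, metric S y a b = metric S y b a.
  by move=> y a b; apply: eq_bigr => i _; rewrite mulrC.
have gC' a b : (fun y => metric S y a b) = (fun y => metric S y b a).
  by apply/funext => y.
rewrite [X in _ = _ + X]gC (gE u v) (gE v u) (gC' v u).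
by move: ('D_w _ x) ('D_u _ x) ('D_v _ x) => a b c; lra.
Qed.

(* Main.v *)
Require Import Defs.
From HB Require Import structures.
From mathcomp Require Import all_boot all_order all_algebra.
From mathcomp Require Import generic_quotient complex.
From mathcomp Require Import all_classical all_reals all_analysis.
From mathcomp Require Import ring lra.
Import Defs.

Set Implicit Arguments.
Unset Strict Implicit.
Unset Printing Implicit Defensive.

Import Order.TTheory GRing.Theory Num.Theory.
Import numFieldNormedType.Exports.

Local Open Scope classical_set_scope.
Local Open Scope ring_scope.

(** The manifold is a torus bundle over a 4-torus: in the orthonormal frame
    E_1, ..., E_6 the only non-closed coframe element is e^6, with de^6 = t
    df^6 and df^6 = 2 (f^34 - f^12). All of the geometry is therefore encoded
    by the constant skew matrix s_ij = df^6(E_i, E_j), which lives on the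
    base, satisfies s s^T = 4 there, and has no (1,1)-trace because the two
    blocks of df^6 have opposite signs.

    A connection whose connection forms have constant coefficients in the
    coframe has curvature d w + w /\ w, again with constant coefficients
    ([curvature_frame_comb]). For the Levi-Civita connection the coefficients
    are t/2 (s_jk d_a6 + s_ak d_j6 - s_aj d_k6). The torsion is T = t^2 f^6 /\
    df^6, and adding T/2 cancels all but one term and doubles that one: the
    forms of nabla^+ are t s_jk e^6 ([connection_forms_bismut]). So nabla^+ is
    abelian, with curvature t^2 s_ji df^6; its holonomy is in su(3) because
    s_12 + s_34 = 0. Squaring, the sum over i < j of Omega_ij /\ Omega_ij is
    -24 t^4 f^1234 for nabla^g and -64 t^4 f^1234 for nabla^+, while dT = -8
    t^2 f^1234.

    The curvature of the instanton is an anti-self-dual form on the base, 2 f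
    (e^12 - e^34) + 2 p (e^13 + e^24) - 2 q (e^23 - e^14) where p + iq is the
    mixed coefficient, of constant length: f^2 + p^2 + q^2 = 1/4. Hence its
    square is -2 f^1234, and comparing coefficients of f^1234 gives both
    Bianchi identities, with 8 t^2 / (12 t^4 - 1) and 8 t^2 / (32 t^4 - 1) for
    alpha'. Conversely dT is not zero, so the Bianchi identity determines
    alpha' ([bianchi_bismutP]).

    In the Einstein equation every term is a multiple of the metric of the
    base: Ric - H^2/4 = -4 t^2, the curvature of A, squared and summed over
    the indices of the bundle, gives 2, and the curvature of nabla^+ gives 64
    t^4; the equation -4 t^2 = alpha'/4 (2 - 64 t^4) is the one that the
    Bianchi identity imposes on alpha'. The Yang-Mills equation on the base is
    the pair of complex equations satisfied by f and gamma
    ([instanton_equations]), and nabla^+ adds nothing to it since its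
    connection forms are multiples of e^6 ([bismut_divergence_asd]). Finally
    M_3 is compact since the product of a compact set of representatives for
    Gamma and of [0, ell] maps onto it. *)

(** * Structure constants *)

(** The value of df^6 does not depend on the point, because f^1, ..., f^4 are
    the coordinate differentials. *)
Definition df6 (R : realType) (u v : 'rV[R]_6) : R :=
  2 * (coord u i3 * coord v i4 - coord u i4 * coord v i3)
  - 2 * (coord u i1 * coord v i2 - coord u i2 * coord v i1).

(** The derivative along the constant field [w] of the function f^6(u); its
    antisymmetrization is [df6]. *)
Definition coframe6_deriv (R : realType) (w u : 'rV[R]_6) : R :=
  2 * coord w i3 * coord u i4 - 2 * coord w i1 * coord u i2.

(** The 4-form f^1234, expanded as f^12 /\ f^34. *)
Definition vol4 (R : realType) (u0 u1 u2 u3 : 'rV[R]_6) : R :=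
  let w i j u v := coord u i * coord v j - coord u j * coord v i in
  w i1 i2 u0 u1 * w i3 i4 u2 u3 - w i1 i2 u0 u2 * w i3 i4 u1 u3
  + w i1 i2 u0 u3 * w i3 i4 u1 u2 + w i1 i2 u1 u2 * w i3 i4 u0 u3
  - w i1 i2 u1 u3 * w i3 i4 u0 u2 + w i1 i2 u2 u3 * w i3 i4 u0 u1.

(** The number s_ij = df^6(E_i, E_j), where E_i may be replaced by a
    coordinate vector because df^6 annihilates the last one. *)
Definition sconst (R : realType) (i j : 'I_6) : R :=
  df6 (delta_mx ord0 i) (delta_mx ord0 j).

Lemma sconstE (R : realType) (i j : 'I_6) : sconst R i j =
  2 * ((i == i3)%:R * (j == i4)%:R - (i == i4)%:R * (j == i3)%:R)
  - 2 * ((i == i1)%:R * (j == i2)%:R - (i == i2)%:R * (j == i1)%:R).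
Proof.
rewrite /sconst /df6 /coord !mxE !eqxx /=.
by rewrite ![_ == i]eq_sym ![_ == j]eq_sym.
Qed.

Lemma sconst_antisym (R : realType) (i j : 'I_6) :
  sconst R j i = - sconst R i j.
Proof. by rewrite /sconst /df6; ring. Qed.

Lemma sconst6l (R : realType) (j : 'I_6) : sconst R i6 j = 0.
Proof. by rewrite sconstE /=; ring. Qed.

Lemma sconst6r (R : realType) (j : 'I_6) : sconst R j i6 = 0.
Proof. by rewrite sconst_antisym sconst6l oppr0. Qed.

(** The metric of the base torus, spanned by E_1, ..., E_4. *)
Definition base_delta (R : realType) (i j : 'I_6) : R :=
  ((i == j) && (i < 4)%N)%:R.

Lemma base_delta6l (R : realType) (j : 'I_6) : base_delta R i6 j = 0.
Proof. by rewrite /base_delta andbF. Qed.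

Lemma base_deltaC (R : realType) (i j : 'I_6) :
  base_delta R i j = base_delta R j i.
Proof. by rewrite /base_delta eq_sym; case: eqP => [->|]. Qed.

(** On the base, the skew matrix s is 2 times an isometry. *)
Lemma sconst_contract (R : realType) (i j : 'I_6) :
  \sum_m sconst R i m * sconst R j m = 4 * base_delta R i j.
Proof.
rewrite big_ord6 !sconstE /base_delta.
by move: i j; apply: ord6P; apply: ord6P => /=; ring.
Qed.

Lemma sconst_norm (R : realType) :
  \sum_l \sum_m sconst R l m * sconst R l m = 16.
Proof.
under eq_bigr => l _ do rewrite sconst_contract.
by rewrite big_ord6 /base_delta /=; ring.
Qed.

Lemma sum_delta6 (R : realType) (F : 'I_6 -> R) :
  \sum_i (i == i6)%:R * F i = F i6.
Proof.
rewrite (bigD1 i6) //= mul1r big1 ?addr0 // => i /negPf ->.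
by rewrite mul0r.
Qed.

(** * The frame and its derivatives *)

Lemma coord_linear (R : realType) (s : R) (u v : 'rV[R]_6) (i : 'I_6) :
  coord (s *: u + v) i = s * coord u i + coord v i.
Proof. by rewrite /coord !mxE. Qed.

Lemma coord_coframe (R : realType) (t : R) (x u : 'rV[R]_6) (i : 'I_6) :
  i != i6 -> coord u i = coframe t i x u.
Proof. by move=> i6n; rewrite /coframe /coframe_f (negPf i6n) mul1r. Qed.

Lemma coframe_t6 (R : realType) (t : R) (t0 : t != 0) (x u : 'rV[R]_6) :
  coframe_f i6 x u = t^-1 * coframe t i6 x u.
Proof. by rewrite /coframe /= mulrA mulVf // mul1r. Qed.

Lemma coord_dual_frame (R : realType) (t : R) x (l i : 'I_6) :
  i != i6 -> coord (dual_frame t l x) i = (i == l)%:R.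
Proof.
move: i l; apply: ord6P => // l _; move: l; apply: ord6P;
  by rewrite /coord /dual_frame /= !mxE /=; ring.
Qed.

Lemma df6_frame (R : realType) (t : R) (x u : 'rV[R]_6) (k : 'I_6) :
  df6 u (dual_frame t k x) = df6 u (delta_mx ord0 k).
Proof.
rewrite /df6 /coord /dual_frame; move: k; apply: ord6P; rewrite /= !mxE /=; ring.
Qed.

Lemma df6_dual_frame (R : realType) (t : R) (x : 'rV[R]_6) (k l : 'I_6) :
  df6 (dual_frame t k x) (delta_mx ord0 l) = sconst R k l.
Proof.
rewrite /sconst /df6 /coord /dual_frame !mxE.
by move: k; apply: ord6P; rewrite /= !mxE /=; ring.
Qed.

Lemma coframe_linear (R : realType) (t : R) (k : 'I_6) (x : 'rV[R]_6)
    (a : R) (u v : 'rV[R]_6) :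
  coframe t k x (a *: u + v) = a * coframe t k x u + coframe t k x v.
Proof.
by rewrite /coframe /coframe_f /coord !mxE; case: (k == i6); ring.
Qed.

Lemma coframeD (R : realType) (t : R) (k : 'I_6) (x u v : 'rV[R]_6) :
  coframe t k x (u + v) = coframe t k x u + coframe t k x v.
Proof. by rewrite -[u]scale1r coframe_linear mul1r scale1r. Qed.

Lemma coframe0 (R : realType) (t : R) (k : 'I_6) (x : 'rV[R]_6) :
  coframe t k x 0 = 0.
Proof. by have := coframeD t k x 0 0; rewrite addr0; lra. Qed.

Lemma coframeZ (R : realType) (t : R) (k : 'I_6) (x : 'rV[R]_6) a u :
  coframe t k x (a *: u) = a * coframe t k x u.
Proof. by rewrite -[_ *: _]addr0 coframe_linear coframe0 addr0. Qed.

Lemma coframeN (R : realType) (t : R) (k : 'I_6) (x : 'rV[R]_6) u :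
  coframe t k x (- u) = - coframe t k x u.
Proof. by rewrite -scaleN1r coframeZ mulN1r. Qed.

Lemma coframe_inj (R : realType) (t : R) (t0 : t != 0) (x u v : 'rV[R]_6) :
  (forall k, coframe t k x u = coframe t k x v) -> u = v.
Proof.
move=> uv; rewrite (frame_decomp x u t0) [RHS](frame_decomp x v t0).
by apply: eq_bigr => k _; rewrite uv.
Qed.

Lemma coord_frame_comb (R : realType) (t : R) (t0 : t != 0) (x : 'rV[R]_6)
    (c : 'I_6 -> R) (i : 'I_6) :
  i != i6 -> coord (\sum_k c k *: dual_frame t k x) i = c i.
Proof.
move=> i6n; rewrite -[RHS](coframe_sum t0 x i c) /coframe /coframe_f.
by rewrite (negPf i6n) mul1r.
Qed.

Lemma coframe_f6_frame_comb (R : realType) (t : R) (t0 : t != 0)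
    (x : 'rV[R]_6) (c : 'I_6 -> R) :
  coframe_f i6 x (\sum_k c k *: dual_frame t k x) = t^-1 * c i6.
Proof.
rewrite -[X in _ = _ * X](coframe_sum t0 x i6 c) /coframe eqxx mulrA.
by rewrite mulVf // mul1r.
Qed.

Lemma is_derive_rV (R : realType) (F : 'rV[R]_6 -> 'rV[R]_6)
    (x u d : 'rV[R]_6) :
  (forall i, is_derive x u (fun y => F y ord0 i) (d ord0 i)) ->
  is_derive x u F d.
Proof.
move=> DF.
have dF : derivable F x u.
  by apply/derivable_mxP => i j; rewrite (ord1 i); case: (DF j).
apply: DeriveDef => //; rewrite derive_mx //; apply/rowP => i.
by rewrite mxE; case: (DF i).
Qed.

(** The frame is affine in the point: only E_2 and E_4 vary, along the last
    coordinate vector. *)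
Definition dual_frame_deriv (R : realType) (k : 'I_6) (u : 'rV[R]_6) : 'rV[R]_6 :=
  (2 * coord u i1 * (k == i2)%:R - 2 * coord u i3 * (k == i4)%:R)
    *: delta_mx ord0 i6.

Lemma is_derive_dual_frame (R : realType) (t : R) (k : 'I_6)
    (x u : 'rV[R]_6) :
  is_derive x u (dual_frame t k) (dual_frame_deriv k u).
Proof.
apply: derive_affine => s; rewrite /dual_frame /dual_frame_deriv.
move: k; apply: ord6P; apply/rowP => i; rewrite /coord /= !mxE /=; ring.
Qed.

(** Leibniz rule for a vector field with variable coefficients in the frame;
    it is checked on coordinates. *)
Lemma is_derive_frame_comb (R : realType) (t : R) (x u : 'rV[R]_6)
    (c : 'I_6 -> 'rV[R]_6 -> R) (dc : 'I_6 -> R) :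
  (forall k, is_derive x u (c k) (dc k)) ->
  is_derive x u (fun y => \sum_k c k y *: dual_frame t k y)
    (\sum_k (dc k *: dual_frame t k x + c k x *: dual_frame_deriv k u)).
Proof.
move=> Dc; apply: is_derive_rV => i.
have -> : (fun y => (\sum_k c k y *: dual_frame t k y) ord0 i)
    = \sum_k (c k * (fun y => dual_frame t k y ord0 i)).
  by apply/funext => y; rewrite summxE fct_sumE; apply: eq_bigr => k _; rewrite mxE.
have -> : (\sum_k (dc k *: dual_frame t k x + c k x *: dual_frame_deriv k u)) ord0 i
    = \sum_k (c k x *: dual_frame_deriv k u ord0 i + dual_frame t k x ord0 i *: dc k).
  rewrite summxE; apply: eq_bigr => k _.
  by rewrite !mxE addrC [X in _ + X]mulrC.
apply: is_derive_sum => k; apply: is_deriveM.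
apply: derive_affine => s; rewrite /dual_frame /dual_frame_deriv.
move: k {Dc}; apply: ord6P; rewrite /coord /= !mxE /GRing.scale /=; ring.
Qed.

Lemma dual_frame_comb (R : realType) (t : R) (j : 'I_6) (x : 'rV[R]_6) :
  dual_frame t j x = \sum_k (k == j)%:R *: dual_frame t k x.
Proof.
rewrite (bigD1 j) //= eqxx scale1r big1 ?addr0 // => k.
by move=> /negPf ->; rewrite scale0r.
Qed.

Lemma metric_t_frame (R : realType) (t : R) (t0 : t != 0)
    (x u : 'rV[R]_6) (i : 'I_6) :
  metric_t t x u (dual_frame t i x) = coframe t i x u.
Proof.
rewrite /metric_t (bigD1 i) //= coframe_dual // eqxx mulr1 big1 ?addr0 // => k.
by move=> /negPf ki; rewrite coframe_dual // ki mulr0.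
Qed.

Lemma is_derive_coord (R : realType) (Y : vfield R) (x u dY : 'rV[R]_6) i :
  is_derive x u Y dY -> is_derive x u (fun y => coord (Y y) i) (coord dY i).
Proof.
move=> DY; have dYx : derivable Y x u by case: DY.
apply: DeriveDef; first exact: ((derivable_mxP _ _ _).1 dYx).
by rewrite -(derive_val (is_derive := DY)) derive_mx // /coord mxE.
Qed.

Lemma is_derive_coframe (R : realType) (t : R) (Y : vfield R)
    (x u dY : 'rV[R]_6) (a : 'I_6) : is_derive x u Y dY ->
  is_derive x u (fun y => coframe t a y (Y y))
    (coframe t a x dY + (a == i6)%:R * t * coframe6_deriv u (Y x)).
Proof.
move=> DY; have Dc i := is_derive_coord i DY.
have [->|a6] := eqVneq a i6; last first.
  rewrite !mul0r addr0 -coord_coframe //.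
  rewrite (_ : (fun y => _) = fun y => coord (Y y) a) //.
  by apply/funext => y; rewrite -coord_coframe.
have Dx i : is_derive x u (fun y => coord y i) (coord u i).
  by apply: derive_affine => s; rewrite coord_linear.
have -> : (fun y => coframe t i6 y (Y y))
    = t *: ((fun y => coord (Y y) i6)
       - 2 *: ((fun y => coord y i1) * (fun y => coord (Y y) i2))
       + 2 *: ((fun y => coord y i3) * (fun y => coord (Y y) i4))).
  apply/funext => y; rewrite /coframe /coframe_f /= !fctE /GRing.scale /=; ring.
have := is_deriveZ t (is_deriveD
  (is_deriveB (Dc i6) (is_deriveZ 2 (is_deriveM (Dx i1) (Dc i2))))
  (is_deriveZ 2 (is_deriveM (Dx i3) (Dc i4)))).
move/is_derive_eq; apply.
rewrite /coframe6_deriv /coframe /coframe_f /= /GRing.scale /=; ring.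
Qed.

Lemma is_derive_coframe_cst (R : realType) (t : R) (j : 'I_6)
    (x w u : 'rV[R]_6) :
  is_derive x w (fun y => coframe t j y u) ((j == i6)%:R * t * coframe6_deriv w u).
Proof.
by have := is_derive_coframe t j (is_derive_cst u x w); rewrite coframe0 add0r.
Qed.

(** * Complex structure and torsion *)

(** The action of J on the components of a vector in the frame. *)
Definition cplx_coord (R : realType) (c : 'I_6 -> R) (k : 'I_6) : R :=
  if k == i1 then c i2 else if k == i2 then - c i1 else
  if k == i3 then c i4 else if k == i4 then - c i3 else
  if k == i5 then c i6 else - c i5.

Lemma cplx_t_frame (R : realType) (t : R) (x u : 'rV[R]_6) :
  cplx_t t x u
  = \sum_k cplx_coord (fun j => coframe t j x u) k *: dual_frame t k x.
Proof.
by rewrite big_ord6 /cplx_coord /= !scaleNr /cplx_t !addrA.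
Qed.

Lemma coframe_cplx (R : realType) (t : R) (t0 : t != 0) (x u : 'rV[R]_6) k :
  coframe t k x (cplx_t t x u) = cplx_coord (fun j => coframe t j x u) k.
Proof. by rewrite cplx_t_frame coframe_sum. Qed.

Lemma coord_cplx (R : realType) (t : R) (t0 : t != 0) (x u : 'rV[R]_6) i :
  i != i6 -> coord (cplx_t t x u) i = cplx_coord (fun j => coframe t j x u) i.
Proof. by move=> i6n; rewrite (coord_coframe t x) // coframe_cplx. Qed.

(** The Chern-Simons form f^6 /\ df^6. *)
Definition f6_df6 (R : realType) : form3 R := fun x u v w =>
  coframe_f i6 x u * df6 v w - coframe_f i6 x v * df6 u w
  + coframe_f i6 x w * df6 u v.

(** Only e^56 contributes to dF, which is - e^5 /\ de^6; composing with J
    turns e^5 into e^6 and preserves e^12 and e^34. *)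
Lemma torsionE (R : realType) (t : R) (t0 : t != 0) (x u v w : 'rV[R]_6) :
  torsion (structure_t t) x u v w = t ^+ 2 * f6_df6 x u v w.
Proof.
have dK a b c : 'D_c (fun y => kaehler (structure_t t) y a b) x
    = t * (coord a i5 * coframe6_deriv c b - coord b i5 * coframe6_deriv c a).
  apply: derive_val; apply: derive_affine => s.
  rewrite !kaehler_t // /wedge11 /coframe /coframe_f /= /GRing.scale /=.
  by rewrite /coframe6_deriv !coord_linear; ring.
rewrite /torsion /d2 !dK /= /f6_df6 /coframe6_deriv /df6.
rewrite !(@coord_coframe _ t x _ i1) // !(@coord_coframe _ t x _ i2) //.
rewrite !(@coord_coframe _ t x _ i3) // !(@coord_coframe _ t x _ i4) //.
rewrite !(@coord_coframe _ t x _ i5) // !(coframe_t6 t0).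
rewrite !(coframe_cplx t0) /cplx_coord /=.
by field.
Qed.

(** This is t^2 df^6 /\ df^6, since df^6 is closed. *)
Lemma d3_torsion (R : realType) (t : R) (t0 : t != 0)
    (x u0 u1 u2 u3 : 'rV[R]_6) :
  d3 (torsion (structure_t t)) x u0 u1 u2 u3 = - 8 * t ^+ 2 * vol4 u0 u1 u2 u3.
Proof.
have dT a b c d : 'D_d (fun y => torsion (structure_t t) y a b c) x
    = t ^+ 2 * (coframe6_deriv d a * df6 b c - coframe6_deriv d b * df6 a c
                + coframe6_deriv d c * df6 a b).
  apply: derive_val; apply: derive_affine => s.
  rewrite !torsionE // /f6_df6 /coframe_f /= /GRing.scale /=.
  by rewrite /coframe6_deriv !coord_linear; ring.
(* From here on only the derivatives of the torsion matter. *)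
move: (torsion _) dT => T dT.
by rewrite /d3 !dT /coframe6_deriv /df6 /vol4 /=; ring.
Qed.

Lemma torsion_frame (R : realType) (t : R) (t0 : t != 0) (x u v : 'rV[R]_6) k :
  torsion (structure_t t) x u v (dual_frame t k x)
  = t * (coframe t i6 x u * df6 v (delta_mx ord0 k)
         - coframe t i6 x v * df6 u (delta_mx ord0 k) + (k == i6)%:R * df6 u v).
Proof.
rewrite torsionE // /f6_df6 !df6_frame.
have := coframe_dual x i6 k t0; rewrite /coframe /= eq_sym => <-.
by ring.
Qed.

(** * Connection forms *)

(** The forms [w k j] are those of [nabla] in the frame: nabla E_j is the sum
    of w k j E_k. The Leibniz rule is part of the definition, so that it can
    be applied to a field and then to its covariant derivative. *)
Definition connection_forms (R : realType) (t : R) (nabla : connection R)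
    (w : 'I_6 -> 'I_6 -> form1 R) : Prop :=
  forall (X : vfield R) (c : 'I_6 -> 'rV[R]_6 -> R) (dc : 'I_6 -> R) x,
    (forall k, is_derive x (X x) (c k) (dc k)) ->
    nabla X (fun y => \sum_k c k y *: dual_frame t k y) x
    = \sum_k (dc k + \sum_j c j x * w k j x (X x)) *: dual_frame t k x.

Definition invariant_forms (R : realType) (t : R)
    (Gam : 'I_6 -> 'I_6 -> 'I_6 -> R) (k j : 'I_6) : form1 R :=
  fun x u => \sum_a Gam a k j * coframe t a x u.

(** Koszul's formula in the frame: the brackets have the only components
    e^6([E_i, E_j]) = - t s_ij. The index [a] is the direction of derivation.
*)
Definition lc_coef (R : realType) (t : R) (a k j : 'I_6) : R :=
  t / 2 * (sconst R j k * (a == i6)%:R + sconst R a k * (j == i6)%:R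
           - sconst R a j * (k == i6)%:R).

(** Half the torsion, t/2 (s_jk d_a6 - s_ak d_j6 + s_aj d_k6), added to
    [lc_coef]. *)
Definition bismut_coef (R : realType) (t : R) (a k j : 'I_6) : R :=
  t * sconst R j k * (a == i6)%:R.

(** The first term is the symmetric part of the derivative of f^6; with the
    derivative of the frame it becomes antisymmetric in
    [connection_forms_levi_civita]. *)
Lemma coframe_christoffel (R : realType) (t : R) (t0 : t != 0)
    (x u v : 'rV[R]_6) (k : 'I_6) :
  coframe t k x (christoffel (structure_t t) x u v)
  = t ^+ 2 / 2 * (
      (coframe6_deriv u v + coframe6_deriv v u)
        * coframe_f i6 x (dual_frame t k x)
    + coframe_f i6 x v * df6 u (dual_frame t k x)
    + coframe_f i6 x u * df6 v (dual_frame t k x)).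
Proof.
rewrite /christoffel.
rewrite (coframe_sum t0 x k (fun k =>
  2^-1 * ('D_u (fun y => metric_t t y v (dual_frame t k x)) x
      + 'D_v (fun y => metric_t t y u (dual_frame t k x)) x
      - 'D_(dual_frame t k x) (fun y => metric_t t y u v) x))).
by rewrite !derive_metric_t /coframe6_deriv /df6; ring.
Qed.

Lemma connection_forms_levi_civita (R : realType) (t : R) (t0 : t != 0) :
  connection_forms t (levi_civita (structure_t t))
    (invariant_forms t (lc_coef t)).
Proof.
move=> X c dc x Dc; set u := X x.
have := is_derive_frame_comb t Dc; rewrite -/u => DY.
rewrite /levi_civita -/u derive_val; apply: (coframe_inj t0) => k.
rewrite coframeD; apply: etrans _ (esym (coframe_sum t0 x k _)).
set Y := \sum_k c k x *: _.
have cY (i : 'I_6) : i != i6 -> coord Y i = c i x by exact: coord_frame_comb.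
have c6 : coframe_f i6 x Y = t^-1 * c i6 x by exact: coframe_f6_frame_comb.
have DE : coframe t k x (\sum_j (dc j *: dual_frame t j x
                                    + c j x *: dual_frame_deriv j u))
    = dc k + t * (2 * coord u i1 * c i2 x - 2 * coord u i3 * c i4 x) * (k == i6)%:R.
  rewrite big_split /= coframeD.
  have -> : coframe t k x (\sum_i dc i *: dual_frame t i x) = dc k.
    exact: coframe_sum.
  rewrite big_ord6 /dual_frame_deriv /= !(coframeD, coframeZ).
  move: k; apply: ord6P; rewrite /coframe /coframe_f /coord /= !mxE /=; ring.
rewrite DE (coframe_christoffel t0) !df6_frame /invariant_forms.
under eq_bigr => j _ do rewrite big_ord6 /lc_coef.
rewrite big_ord6 c6 !sconstE.
have Eu i : i != i6 -> coframe t i x u = coord u i.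
  by move=> i6n; rewrite -coord_coframe.
have E6 : coframe t i6 x u = t * coframe_f i6 x u by [].
rewrite E6 !Eu // /coframe6_deriv /df6 !cY //.
by move: k {DE}; apply: ord6P;
  rewrite /coframe_f /dual_frame /coord /= !mxE /=; field.
Qed.

Lemma connection_forms_bismut (R : realType) (t : R) (t0 : t != 0) :
  connection_forms t (bismut (structure_t t))
    (invariant_forms t (bismut_coef t)).
Proof.
move=> X c dc x Dc; rewrite /bismut (connection_forms_levi_civita t0 Dc).
rewrite -big_split /=; apply: eq_bigr => k _; rewrite -scalerDl; congr (_ *: _).
rewrite -addrA; congr (_ + _); rewrite torsion_frame //; set u := X x.
set Y := \sum_k c k x *: dual_frame t k x.
have cY (i : 'I_6) : i != i6 -> coord Y i = c i x by exact: coord_frame_comb.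
have c6 : coframe t i6 x Y = c i6 x by exact: coframe_sum.
rewrite c6 /invariant_forms.
rewrite !big_ord6 /lc_coef /bismut_coef !sconstE /df6 !cY //.
rewrite !(@coord_coframe _ t x u) // /coord !mxE /=.
by move: k; apply: ord6P => /=; field.
Qed.

Lemma connection_forms_frame (R : realType) (t : R) (nabla : connection R)
    (w : 'I_6 -> 'I_6 -> form1 R) (nablaE : connection_forms t nabla w)
    (X : vfield R) (j : 'I_6) (x : 'rV[R]_6) :
  nabla X (dual_frame t j) x = \sum_k w k j x (X x) *: dual_frame t k x.
Proof.
have -> : dual_frame t j
    = fun y => \sum_k cst (k == j)%:R y *: dual_frame t k y.
  by apply/funext => y; exact: dual_frame_comb.
rewrite (nablaE X (fun k => cst (k == j)%:R) (fun=> 0)); apply: eq_bigr => k _.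
rewrite add0r (bigD1 j) //= eqxx mul1r big1 ?addr0 // => l /negPf ->.
by rewrite mul0r.
Qed.

Lemma invariant_forms_frame (R : realType) (t : R) (t0 : t != 0)
    (Gam : 'I_6 -> 'I_6 -> 'I_6 -> R) (a k j : 'I_6) (x : 'rV[R]_6) :
  invariant_forms t Gam k j x (dual_frame t a x) = Gam a k j.
Proof.
rewrite /invariant_forms (bigD1 a) //= coframe_dual // eqxx mulr1.
by rewrite big1 ?addr0 // => l /negPf la; rewrite coframe_dual // la mulr0.
Qed.

(** * Curvature *)

(** The (i, j) entry of d w + w /\ w; only the e^6 component of w contributes
    to d w. *)
Definition invariant_curv (R : realType) (t : R)
    (Gam : 'I_6 -> 'I_6 -> 'I_6 -> R) (i j : 'I_6) : form2 R := fun x u v =>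
  let w := invariant_forms t Gam in
  t * Gam i6 i j * df6 u v
  + \sum_l (w i l x u * w l j x v - w i l x v * w l j x u).

(** The second covariant derivatives differentiate w(Y) and w(X); the
    derivatives of the arguments X and Y cancel against the bracket, and what
    is left of the first order part is d w. *)
Lemma curvature_frame_comb (R : realType) (t : R) (t0 : t != 0)
    (nabla : connection R) (Gam : 'I_6 -> 'I_6 -> 'I_6 -> R)
    (nablaE : connection_forms t nabla (invariant_forms t Gam))
    (X Y : vfield R) (c : 'I_6 -> R) (x : 'rV[R]_6) (i : 'I_6) :
  derivable X x (Y x) -> derivable Y x (X x) ->
  coframe t i x
    (curvature nabla X Y (fun y => \sum_j c j *: dual_frame t j y) x)
  = \sum_j c j * invariant_curv t Gam i j x (X x) (Y x).
Proof.
move=> dX dY; pose w := invariant_forms t Gam.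
have nabE Z y : nabla Z (fun y => \sum_j c j *: dual_frame t j y) y
    = \sum_k (\sum_j c j * w k j y (Z y)) *: dual_frame t k y.
  rewrite (nablaE Z (fun k => cst (c k)) (fun=> 0)).
  by apply: eq_bigr => k _; rewrite add0r.
have nab2 Z W : derivable W x (Z x) ->
    nabla Z (nabla W (fun y => \sum_j c j *: dual_frame t j y)) x
    = \sum_k (\sum_j c j * (\sum_a Gam a k j * (coframe t a x ('D_(Z x) W x)
        + (a == i6)%:R * t * coframe6_deriv (Z x) (W x)))
        + \sum_j (\sum_l c l * w j l x (W x)) * w k j x (Z x))
      *: dual_frame t k x.
  move=> dW.
  have -> : nabla W (fun y => \sum_j c j *: dual_frame t j y)
      = fun y => \sum_k (\sum_j c j * w k j y (W y)) *: dual_frame t k y.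
    by apply/funext => y; rewrite nabE.
  apply: (nablaE Z) => k; have DW := derivableP dW.
  have Dco a := is_derive_coframe t a DW.
  rewrite (_ : (fun y => _) = \sum_j c j *: \sum_a Gam a k j
             *: (fun y => coframe t a y (W y))); last first.
    apply/funext => y; rewrite fct_sumE; apply: eq_bigr => j _.
    by rewrite !fctE /w /invariant_forms fct_sumE.
  apply: is_derive_sum => j; apply: is_deriveZ; apply: is_derive_sum => a.
rewrite /curvature nab2 // nab2 // nabE !(coframeD, coframeN).
do ![rewrite (@coframe_sum _ t t0 x i (fun k => _))].
have exch U V : \sum_j (\sum_l c l * w j l x V) * w i j x U
    = \sum_l c l * \sum_j w i j x U * w j l x V.
  under eq_bigr => j _ do rewrite mulr_suml.
  rewrite exchange_big /=; apply: eq_bigr => l _.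
  by rewrite mulr_sumr; apply: eq_bigr => j _; ring.
rewrite !exch opprD -!sumrN -!big_split /=.
apply: eq_bigr => j _; rewrite /invariant_curv -/w sumrB.
have -> : w i j x (bracket X Y x)
    = \sum_a Gam a i j * (coframe t a x ('D_(X x) Y x)
                          - coframe t a x ('D_(Y x) X x)).
  by apply: eq_bigr => a _; rewrite /bracket coframeD coframeN.
(* A and B stand for the components of D_X Y and D_Y X, whose difference is the
   bracket. *)
have d6 (A B : 'I_6 -> R) p q :
    \sum_a Gam a i j * (A a + (a == i6)%:R * t * p)
    = \sum_a Gam a i j * (B a + (a == i6)%:R * t * q)
      + \sum_a Gam a i j * (A a - B a) + t * Gam i6 i j * (p - q).
  by rewrite !big_ord6 /=; ring.
rewrite (d6 _ (fun a => coframe t a x ('D_(Y x) X x)) _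
  (coframe6_deriv (Y x) (X x))).
rewrite /df6 /coframe6_deriv.
move: (\sum_a _) (\sum_a _) (\sum_a _) (\sum_a _) => S1 S2 S3 S4.
ring.
Qed.

(** The curvature is tensorial in its first two arguments, so constant vector
    fields and the frame give the same 2-forms. *)
Lemma curvature_invariant (R : realType) (t : R) (t0 : t != 0)
    (nabla : connection R) (Gam : 'I_6 -> 'I_6 -> 'I_6 -> R)
    (nablaE : connection_forms t nabla (invariant_forms t Gam))
    (X Y : vfield R) (i j : 'I_6) (x : 'rV[R]_6) :
  derivable X x (Y x) -> derivable Y x (X x) ->
  metric_t t x (curvature nabla X Y (dual_frame t j) x) (dual_frame t i x)
  = invariant_curv t Gam i j x (X x) (Y x).
Proof.
move=> dX dY; rewrite metric_t_frame //.
have -> : dual_frame t j = fun y => \sum_k (k == j)%:R *: dual_frame t k y.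
  by apply/funext => y; exact: dual_frame_comb.
rewrite (curvature_frame_comb t0 nablaE) // (bigD1 j) //= eqxx mul1r big1 ?addr0 // => k.
by move=> /negPf ->; rewrite mul0r.
Qed.

(** All connection forms are multiples of e^6, so w /\ w vanishes. *)
Lemma bismut_curvE (R : realType) (t : R) (i j : 'I_6) (x u v : 'rV[R]_6) :
  invariant_curv t (bismut_coef t) i j x u v = t ^+ 2 * sconst R j i * df6 u v.
Proof.
have wE k l y : invariant_forms t (bismut_coef t) k l x y
    = t * sconst R l k * coframe t i6 x y.
  by rewrite /invariant_forms big_ord6 /bismut_coef /=; ring.
rewrite /invariant_curv big1 => [|l _]; last by rewrite !wE; ring.
by rewrite addr0 /bismut_coef eqxx /=; ring.
Qed.

(** In components, with a_i the contraction of df^6 with E_i and e^i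
    restricted to the base: t^2 (s_ji df^6 / 2 - a_i /\ a_j / 4) on the base,
    and t^2 e^i /\ e^6 for j = 6. *)
Definition lc_curv (R : realType) (t : R) (i j : 'I_6) : form2 R := fun x u v =>
  let e (k : 'I_6) y := (k < 4)%N%:R * coord y k in
  let a k y := df6 y (delta_mx ord0 k) in
  let e6 y := coframe t i6 x y in
  t ^+ 2 * (sconst R j i * df6 u v / 2 - (a i u * a j v - a i v * a j u) / 4
            + (j == i6)%:R * (e i u * e6 v - e i v * e6 u)
            - (i == i6)%:R * (e j u * e6 v - e j v * e6 u)).

Lemma lc_curvE (R : realType) (t : R) (i j : 'I_6) (x u v : 'rV[R]_6) :
  invariant_curv t (lc_coef t) i j x u v = lc_curv t i j x u v.
Proof.
pose a k (y : 'rV[R]_6) := df6 y (delta_mx ord0 k).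
have aE k y : a k y = \sum_l sconst R l k * ((l < 4)%N%:R * coord y l).
  rewrite big_ord6 !sconstE /a /df6 /coord !mxE /=.
  by move: k; apply: ord6P => /=; ring.
have wE k l y : invariant_forms t (lc_coef t) k l x y
    = t / 2 * (sconst R l k * coframe t i6 x y
               + (l == i6)%:R * a k y - (k == i6)%:R * a l y).
  rewrite /invariant_forms !aE !big_ord6 /lc_coef !sconstE /=.
  rewrite !(@coord_coframe _ t x y i1) // !(@coord_coframe _ t x y i2) //.
  rewrite !(@coord_coframe _ t x y i3) // !(@coord_coframe _ t x y i4) //.
  move: (coframe _ i1 _ _) (coframe _ i2 _ _) (coframe _ i3 _ _) (coframe _ i4 _ _).
  by move: (coframe _ i5 _ _) (coframe _ i6 _ _) => *; ring.
rewrite /invariant_curv /lc_curv /= big_ord6 !wE.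
rewrite /a /df6 /coord !mxE !sconstE /lc_coef !sconstE /=.
move: (coframe t i6 x u) (coframe t i6 x v) {wE aE} => p q.
move: (u ord0) (v ord0) => b c.
by move: i j; apply: ord6P; apply: ord6P => /=; field.
Qed.

(** * Pontrjagin forms *)

Lemma curv_form_lc (R : realType) (t : R) (t0 : t != 0) i j :
  curv_form (structure_t t) (levi_civita (structure_t t)) i j = lc_curv t i j.
Proof.
apply/funext => x; apply/funext => u; apply/funext => v.
rewrite -lc_curvE.
exact: (curvature_invariant t0 (connection_forms_levi_civita t0)
  (X := cst u) (Y := cst v) i j).
Qed.

Lemma curv_form_bismut (R : realType) (t : R) (t0 : t != 0) i j :
  curv_form (structure_t t) (bismut (structure_t t)) i j
  = fun x u v => t ^+ 2 * sconst R j i * df6 u v.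
Proof.
apply/funext => x; apply/funext => u; apply/funext => v.
rewrite -(bismut_curvE t i j x u v).
exact: (curvature_invariant t0 (connection_forms_bismut t0)
  (X := cst u) (Y := cst v) i j).
Qed.

(** Omega_12 = t^2 (2 f^34 - 3 f^12) and Omega_34 = t^2 (2 f^12 - 3 f^34),
    while the other entries are decomposable. *)
Lemma wedge22_lc_curv (R : realType) (t : R) (i j : 'I_6) x u0 u1 u2 u3 :
  (i < j)%N -> wedge22 (lc_curv t i j) (lc_curv t i j) x u0 u1 u2 u3
  = - 12 * t ^+ 4 * ((i == i1) && (j == i2) || (i == i3) && (j == i4))%:R
    * vol4 u0 u1 u2 u3.
Proof.
move=> ij; rewrite /wedge22 /lc_curv /vol4 /df6 /coord !mxE !sconstE /=.
move: (coframe _ _ _ u0) (coframe _ _ _ u1) => a b.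
move: (coframe _ _ _ u2) (coframe _ _ _ u3) => c d.
move: (u0 ord0) (u1 ord0) (u2 ord0) (u3 ord0) => v0 v1 v2 v3.
by move: i j ij; apply: ord6P; apply: ord6P => // _ /=; field.
Qed.

Lemma pontrjagin_lc (R : realType) (t : R) (t0 : t != 0) x u0 u1 u2 u3 :
  pontrjagin (curv_form (structure_t t) (levi_civita (structure_t t)))
    x u0 u1 u2 u3
  = (8 * pi ^+ 2)^-1 * (- 24 * t ^+ 4 * vol4 u0 u1 u2 u3).
Proof.
rewrite /pontrjagin; congr (_ * _).
under eq_bigr => i _ do under eq_bigr => j ij do
  rewrite !curv_form_lc // wedge22_lc_curv //.
under eq_bigr => i _ do rewrite big_mkcond big_ord6 /=.
by rewrite big_ord6 /=; ring.
Qed.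

Lemma pontrjagin_bismut (R : realType) (t : R) (t0 : t != 0) x u0 u1 u2 u3 :
  pontrjagin (curv_form (structure_t t) (bismut (structure_t t)))
    x u0 u1 u2 u3
  = (8 * pi ^+ 2)^-1 * (- 64 * t ^+ 4 * vol4 u0 u1 u2 u3).
Proof.
rewrite /pontrjagin; congr (_ * _).
have sq (i j : 'I_6) : wedge22
      (curv_form (structure_t t) (bismut (structure_t t)) i j)
      (curv_form (structure_t t) (bismut (structure_t t)) i j) x u0 u1 u2 u3
    = - 8 * t ^+ 4 * sconst R j i ^+ 2 * vol4 u0 u1 u2 u3.
  rewrite curv_form_bismut // /wedge22 /vol4 /df6 /=.
  by move: (sconst _ _ _) => s; ring.
under eq_bigr => i _ do under eq_bigr => j _ do rewrite sq.
under eq_bigr => i _ do rewrite big_mkcond big_ord6 !sconstE /=.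
by rewrite big_ord6 /=; ring.
Qed.

Lemma sum_symmetric (R : realType) (n : nat) (F : 'I_n -> 'I_n -> R) :
  (forall i j, F j i = F i j) -> (forall i, F i i = 0) ->
  \sum_(i < n) \sum_(j < n) F i j = 2 * \sum_(i < n) \sum_(j < n | (i < j)%N) F i j.
Proof.
move=> Fsym F0.
have -> : \sum_(i < n) \sum_(j < n) F i j
    = \sum_(i < n) \sum_(j < n | (i < j)%N) F i j
    + \sum_(i < n) \sum_(j < n | (j < i)%N) F i j.
  rewrite -big_split; apply: eq_bigr => i _.
  rewrite (bigD1 i) //= F0 add0r (bigID (fun j : 'I_n => (i < j)%N)) /=.
  by congr (_ + _); apply: eq_bigl => j; rewrite -val_eqE neq_ltn;
    case: ltngtP.
rewrite mulr_natl mulr2n; congr (_ + _).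
rewrite (exchange_big_dep predT) //=.
by apply: eq_bigr => i _; apply: eq_bigr => j _.
Qed.

Lemma pi_neq0 (R : realType) : (pi : R) != 0.
Proof. by rewrite lt0r_neq0 ?pi_gt0. Qed.

Lemma trace_sq_pontrjagin (R : realType) (n : nat)
    (Om : 'I_n -> 'I_n -> form2 R) x u0 u1 u2 u3 :
  (forall i j u v, Om j i x u v = - Om i j x u v) ->
  trace_sq Om x u0 u1 u2 u3 = 16 * pi ^+ 2 * pontrjagin Om x u0 u1 u2 u3.
Proof.
move=> Oanti; rewrite /trace_sq sum_symmetric.
- have := pi_neq0 R.
  rewrite /pontrjagin mulrA; move: pi => p p0; congr (_ * _).
  by field; exact: p0.
- by move=> i j; rewrite /wedge22 !(Oanti i j) ; ring.
- move=> i; rewrite /wedge22; have O0 u v : Om i i x u v = 0.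
    by have := Oanti i i u v; lra.
  by rewrite !O0; ring.
Qed.

(** * The Hermitian structure and the gravitino equation *)

Lemma is_derive_cplx (R : realType) (t : R) (x w u : 'rV[R]_6) :
  is_derive x w (cplx_t t ^~ u)
    (\sum_k (cplx_coord (fun j => (j == i6)%:R * t * coframe6_deriv w u) k *: dual_frame t k x
      + cplx_coord (fun j => coframe t j x u) k *: dual_frame_deriv k w)).
Proof.
rewrite (_ : cplx_t t ^~ u = fun y =>
    \sum_k cplx_coord (fun j => coframe t j y u) k *: dual_frame t k y); last first.
  by apply/funext => y; exact: cplx_t_frame.
apply: is_derive_frame_comb => k.
have D j := is_derive_coframe_cst t j x w u.
have DN j := is_deriveN (D j).
by move: k; apply: ord6P; rewrite /cplx_coord /=; (exact: D || exact: DN).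
Qed.

(** J u has constant components along E_1, ..., E_4, so only the E_5
    component, e^6(u), and the variation of E_2 and E_4 contribute. *)
Lemma coframe_derive_cplx (R : realType) (t : R) (t0 : t != 0)
    (x w u : 'rV[R]_6) (k : 'I_6) :
  coframe t k x ('D_w (cplx_t t ^~ u) x)
  = (k == i5)%:R * t * coframe6_deriv w u
  + (k == i6)%:R * t * (2 * coord w i3 * coord u i3 - 2 * coord w i1 * coord u i1).
Proof.
have D := is_derive_cplx t x w u; rewrite derive_val {D}.
rewrite big_split /= coframeD.
set c := cplx_coord _.
have -> : coframe t k x (\sum_i c i *: dual_frame t i x) = c k.
  exact: coframe_sum.
rewrite big_ord6 /dual_frame_deriv /c /cplx_coord /= !(coframeD, coframeZ).
rewrite /coframe /coframe_f /coord /= !mxE /=.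
by move: k {c}; apply: ord6P => /=; ring.
Qed.

(** With the derivatives of J u known, the Nijenhuis tensor is an expression
    in frame components; it vanishes because df^6 is of type (1,1). *)
Lemma nijenhuis_t (R : realType) (t : R) (t0 : t != 0) (x u v : 'rV[R]_6) :
  nijenhuis (cplx_t t) x u v = 0.
Proof.
pose J := cplx_t t x; pose DJ w z := 'D_w (cplx_t t ^~ z) x.
change (DJ (J u) v - DJ (J v) u - J ('D_(J u) (cst v) x - DJ v u)
  - J (DJ u v - 'D_(J v) (cst u) x) - ('D_u (cst v) x - 'D_v (cst u) x) = 0).
have cDJ k w z : coframe t k x (DJ w z) = _ :=
  coframe_derive_cplx t0 x w z k.
have cJ k z : coframe t k x (J z) = cplx_coord (fun j => coframe t j x z) k.
  exact: coframe_cplx.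
have oJ z i : i != i6 -> coord (J z) i
    = cplx_coord (fun j => coframe t j x z) i by exact: coord_cplx.
move: DJ J cDJ cJ oJ => DJ J cDJ cJ oJ.
rewrite !derive_cst subrr !subr0 sub0r.
apply: (coframe_inj t0 (x := x)) => k.
rewrite !(coframeD, coframeN) coframe0 !cJ /cplx_coord !coframeN !cDJ.
rewrite /coframe6_deriv !oJ //.
rewrite /cplx_coord /=.
rewrite !(@coord_coframe _ t x _ i1) // !(@coord_coframe _ t x _ i2) //.
rewrite !(@coord_coframe _ t x _ i3) // !(@coord_coframe _ t x _ i4) //.
by move: k; apply: ord6P => /=; ring.
Qed.

Lemma hermitian_t (R : realType) (t : R) (t0 : t != 0) :
  hermitian (structure_t t).
Proof.
split=> [x i j|x u|x u v|x u v] /=.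
- by rewrite metric_t_frame // coframe_dual // eq_sym.
- apply: (coframe_inj t0 (x := x)) => k; rewrite coframeN !coframe_cplx //.
  move: k; apply: ord6P; rewrite /cplx_coord /= !coframe_cplx //;
  by rewrite /cplx_coord /= ?opprK.
- rewrite /metric_t !big_ord6 !coframe_cplx // /cplx_coord /=; ring.
- exact: nijenhuis_t.
Qed.

(** The trace is 2 t^2 (s_21 + s_43) df^6, and s_21 + s_43 = 0. *)
Lemma su3_holonomy_t (R : realType) (t : R) (t0 : t != 0) :
  su3_holonomy (structure_t t).
Proof.
move=> x u v /=.
under eq_bigr => i _.
  rewrite metric_t_frame // (_ : (fun y => _) = fun y => \sum_k
    cplx_coord (fun j => (j == i)%:R) k *: dual_frame t k y); last first.
    apply/funext => y; rewrite cplx_t_frame; apply: eq_bigr => k _.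
    by congr (cplx_coord _ _ *: _); apply/funext => j; rewrite coframe_dual.
  rewrite (curvature_frame_comb t0 (connection_forms_bismut t0)) //.
  under eq_bigr => j _ do rewrite bismut_curvE.
  over.
under eq_bigr => i _ do rewrite big_ord6 !sconstE /cplx_coord /=.
by rewrite big_ord6 /=; ring.
Qed.

(** * The balanced condition *)

Lemma kaehler_frame (R : realType) (t : R) (t0 : t != 0) (x u : 'rV[R]_6) i :
  kaehler (structure_t t) x (dual_frame t i x) u
  = cplx_coord (fun j => coframe t j x u) i.
Proof.
rewrite /kaehler /= /metric_t (bigD1 i) //= coframe_dual // eqxx mul1r.
rewrite big1 ?addr0 ?coframe_cplx // => k /negPf ki.
by rewrite coframe_dual // ki mul0r.
Qed.

Lemma kaehler_frame_comb (R : realType) (t : R) (t0 : t != 0) (x : 'rV[R]_6)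
    (c : 'I_6 -> R) (i : 'I_6) :
  kaehler (structure_t t) x (dual_frame t i x) (\sum_k c k *: dual_frame t k x)
  = cplx_coord c i.
Proof.
rewrite kaehler_frame //; congr cplx_coord; apply/funext => j.
exact: coframe_sum.
Qed.

Lemma kaehler0 (R : realType) (t : R) (x u : 'rV[R]_6) :
  kaehler (structure_t t) x 0 u = 0.
Proof.
by rewrite /kaehler /= /metric_t big1 // => k _; rewrite coframe0 mul0r.
Qed.

(** s is skew and s_i6 = 0, so the coefficients with a = j vanish. *)
Lemma levi_civita_frame_geodesic (R : realType) (t : R) (t0 : t != 0) i x :
  levi_civita (structure_t t) (dual_frame t i) (dual_frame t i) x = 0.
Proof.
rewrite (connection_forms_frame (connection_forms_levi_civita t0)) big1 // => k _.
rewrite invariant_forms_frame // (_ : lc_coef t i k i = 0) ?scale0r //.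
by rewrite /lc_coef !sconstE; move: k i; do 2![apply: ord6P]; rewrite /=; ring.
Qed.

Lemma levi_civita_frame_cst (R : realType) (t : R) (t0 : t != 0) i
    (u x : 'rV[R]_6) :
  levi_civita (structure_t t) (dual_frame t i) (cst u) x
  = \sum_k ((k == i6)%:R * t * coframe6_deriv (dual_frame t i x) u
            + \sum_j coframe t j x u * lc_coef t i k j) *: dual_frame t k x.
Proof.
have -> : cst u = fun y => \sum_k coframe t k y u *: dual_frame t k y.
  by apply/funext => y; rewrite -frame_decomp.
have D k := is_derive_coframe_cst t k x (dual_frame t i x) u.
rewrite (connection_forms_levi_civita t0 D).
apply: eq_bigr => k _; congr ((_ + _) *: _); apply: eq_bigr => j _.
by rewrite invariant_forms_frame.
Qed.

(** The derivatives of the components of [u] cancel, and the terms left over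
    form the contraction of df^6 with F, which is proportional to s_12 + s_34.
*)
Lemma balanced_t (R : realType) (t : R) (t0 : t != 0) :
  balanced (structure_t t).
Proof.
move=> x u'; rewrite /lee_form; move: (cplx _ _ u') => u {u'}.
apply/eqP; rewrite /codiff_kaehler oppr_eq0; apply/eqP.
rewrite /cov2.
have dK i : 'D_(dual_frame t i x) (fun y => kaehler (structure_t t) y
      (dual_frame t i y) u) x
    = cplx_coord (fun k => (k == i6)%:R * t *
        coframe6_deriv (dual_frame t i x) u) i.
  have D j := is_derive_coframe_cst t j x (dual_frame t i x) u.
  have DN j := is_deriveN (D j).
  rewrite (_ : (fun y => _) = fun y => cplx_coord (fun j => coframe t j y u) i).
    by apply: derive_val; move: i D DN; apply: ord6P => D DN;
      rewrite /cplx_coord /=; (exact: D || exact: DN).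
  by apply/funext => y; rewrite kaehler_frame.
under eq_bigr => i _.
  rewrite dK levi_civita_frame_geodesic // kaehler0 subr0.
  rewrite levi_civita_frame_cst // kaehler_frame_comb //.
  over.
under eq_bigr => i _ do rewrite {2}/cplx_coord !big_ord6 /lc_coef !sconstE.
rewrite big_ord6 /cplx_coord /=.
do 6![move: (coframe6_deriv _ _) => ?]; do 6![move: (coframe _ _ _ _) => ?].
ring.
Qed.

(** * Flux and Ricci tensor *)

Definition torsion_coef (R : realType) (t : R) (i j k : 'I_6) : R :=
  t * ((i == i6)%:R * sconst R j k - (j == i6)%:R * sconst R i k
       + (k == i6)%:R * sconst R i j).

Lemma torsion_frame_comb (R : realType) (t : R) (t0 : t != 0) x c j k :
  torsion (structure_t t) x (\sum_l c l *: dual_frame t l x)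
    (dual_frame t j x) (dual_frame t k x)
  = \sum_l c l * torsion_coef t l j k.
Proof.
rewrite torsion_frame // coframe_sum // coframe_dual //.
set C := \sum_l c l *: _.
have cC i : i != i6 -> coord C i = c i by exact: coord_frame_comb.
rewrite df6_frame /df6 !cC //.
rewrite !coord_dual_frame // /coord !mxE !eqxx big_ord6 /torsion_coef !sconstE /=.
rewrite ![_ == j]eq_sym ![_ == k]eq_sym.
by ring.
Qed.

Lemma torsion_frameE (R : realType) (t : R) (t0 : t != 0) x i j k :
  torsion (structure_t t) x (dual_frame t i x) (dual_frame t j x)
    (dual_frame t k x) = torsion_coef t i j k.
Proof.
rewrite {1}(dual_frame_comb t i x) torsion_frame_comb // (bigD1 i) //= eqxx.
by rewrite mul1r big1 ?addr0 // => l /negPf ->; rewrite mul0r.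
Qed.

Lemma torsion_swap (R : realType) (t : R) (t0 : t != 0) x u v w :
  torsion (structure_t t) x v u w = - torsion (structure_t t) x u v w.
Proof. by rewrite !torsionE // /f6_df6 /df6; ring. Qed.

Lemma torsion_rot (R : realType) (t : R) (t0 : t != 0) x u v w :
  torsion (structure_t t) x u v w = torsion (structure_t t) x w u v.
Proof. by rewrite !torsionE // /f6_df6 /df6; ring. Qed.

(** Because s_i6 = 0, the nine products reduce to three, and two of these
    cancel after summation. *)
Lemma lc_coef_torsion_coef (R : realType) (t : R) j k :
  \sum_i \sum_l lc_coef t i l j * torsion_coef t l i k
  = - 8 * t ^+ 2 * ((j == i6) && (k == i6))%:R.
Proof.
have pE i l : lc_coef t i l j * torsion_coef t l i k = t ^+ 2 / 2 *
    ((i == i6)%:R * (sconst R j l * sconst R k l)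
     - ((j == i6) && (k == i6))%:R * (sconst R i l * sconst R i l)
     - (l == i6)%:R * (sconst R j i * sconst R k i)).
  rewrite /lc_coef /torsion_coef -mulnb natrM (sconst_antisym R k l).
  rewrite (sconst_antisym R i l) (sconst_antisym R j i) (sconst_antisym R k i).
  have [->|_] := eqVneq i i6; have [->|_] := eqVneq l i6;
  have [->|_] := eqVneq j i6; have [->|_] := eqVneq k i6;
    by rewrite ?sconst6l ?sconst6r /=; field.
under eq_bigr => i _ do under eq_bigr => l _ do rewrite pE.
under eq_bigr => i _ do rewrite -mulr_sumr !sumrB -!mulr_sumr sum_delta6.
rewrite -mulr_sumr !sumrB -!mulr_sumr sum_delta6 sconst_norm !sconst_contract.
by field.
Qed.

(** Since the frame components of T are constant, the divergence is the
    antisymmetrization of a tensor that [lc_coef_torsion_coef] shows to be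
    symmetric. *)
Lemma torsion_coclosed (R : realType) (t : R) (t0 : t != 0) j k x :
  let S := structure_t t in
  \sum_i cov3 (levi_civita S) (torsion S) (dual_frame t i) (dual_frame t i)
    (dual_frame t j) (dual_frame t k) x = 0.
Proof.
move=> S; have covE i : cov3 (levi_civita S) (torsion S) (dual_frame t i)
      (dual_frame t i) (dual_frame t j) (dual_frame t k) x
    = \sum_l lc_coef t i l j * torsion_coef t l i k
    - \sum_l lc_coef t i l k * torsion_coef t l i j.
  rewrite /cov3 levi_civita_frame_geodesic //.
  rewrite (_ : (fun y => _) = cst (torsion_coef t i j k)); last first.
    by apply/funext => y; rewrite torsion_frameE.
  rewrite derive_cst.
  have T0 : torsion S x 0 (dual_frame t j x) (dual_frame t k x) = 0.
    by rewrite torsion_frame // coframe0 /df6 /coord !mxE; ring.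
  rewrite T0 (torsion_swap t0 x (levi_civita _ _ _ _)) (torsion_rot t0 _ _ (_ j x)).
  rewrite !(connection_forms_frame (connection_forms_levi_civita t0)).
  rewrite !torsion_frame_comb // subr0 sub0r opprK; congr (_ - _);
    by apply: eq_bigr => l _; rewrite invariant_forms_frame.
under eq_bigr do rewrite covE.
by rewrite sumrB !lc_coef_torsion_coef andbC subrr.
Qed.

(** The base directions receive -3 t^2 from the curvature of the base and t^2
    from the plane spanned with E_6. *)
Lemma ricci_t (R : realType) (t : R) (t0 : t != 0) (i j : 'I_6) x :
  ricci (structure_t t) i j x
  = t ^+ 2 * (4 * ((i == i6) && (j == i6))%:R - 2 * base_delta R i j).
Proof.
have dE k y u : derivable (dual_frame t k) y u.
  by case: (is_derive_dual_frame t k y u).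
rewrite /ricci /=; under eq_bigr => k _.
  rewrite (curvature_invariant t0 (connection_forms_levi_civita t0)) // lc_curvE.
  rewrite /lc_curv !df6_frame.
  over.
have bE (a l : 'I_6) : (a < 4)%N%:R * coord (dual_frame t l x) a
    = base_delta R a l.
  rewrite /base_delta andbC -mulnb natrM; case: ltnP => [a4|_]; last by rewrite !mul0r.
  rewrite (coord_coframe t x) ?coframe_dual //.
  by apply: contraTneq a4 => ->.
have kE k : t ^+ 2 * (sconst R j k * sconst R k i / 2
      - (sconst R k k * sconst R i j - sconst R i k * sconst R k j) / 4
      + (j == i6)%:R * (base_delta R k k * (i6 == i)%:R
                        - base_delta R k i * (i6 == k)%:R)
      - (k == i6)%:R * (base_delta R j k * (i6 == i)%:R
                        - base_delta R j i * (i6 == k)%:R))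
    = t ^+ 2 * ((k == i6)%:R * base_delta R i j
        - 3 / 4 * (sconst R i k * sconst R j k)
        + ((i == i6) && (j == i6))%:R * base_delta R k k).
  rewrite -mulnb natrM (sconst_antisym R i k) (sconst_antisym R j k).
  have -> : sconst R k k = 0 by have := sconst_antisym R k k; lra.
  rewrite ![i6 == _]eq_sym (base_deltaC R j i).
  have [->|_] := eqVneq k i6; last by rewrite /=; field.
  by rewrite (base_deltaC R j i6) !base_delta6l !sconst6r /=; field.
under eq_bigr => k _ do
  rewrite !df6_dual_frame !bE !coframe_dual // kE.
rewrite -mulr_sumr big_split sumrB /= sum_delta6 -!mulr_sumr sconst_contract.
by rewrite [in X in _ + X]big_ord6 /base_delta /=; field.
Qed.

Lemma flux_sq_t (R : realType) (t : R) (t0 : t != 0) (i j : 'I_6) x :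
  flux_sq (structure_t t) i j x
  = t ^+ 2 * (16 * ((i == i6) && (j == i6))%:R + 8 * base_delta R i j).
Proof.
rewrite /flux_sq /=.
have pE m n : torsion_coef t i m n * torsion_coef t j m n = t ^+ 2 *
    (((i == i6) && (j == i6))%:R * (sconst R m n * sconst R m n)
     + (m == i6)%:R * (sconst R i n * sconst R j n)
     + (n == i6)%:R * (sconst R i m * sconst R j m)).
  rewrite /torsion_coef -mulnb natrM.
  have [->|_] := eqVneq m i6; have [->|_] := eqVneq n i6;
  have [->|_] := eqVneq i i6; have [->|_] := eqVneq j i6;
    by rewrite ?sconst6l ?sconst6r /=; ring.
under eq_bigr => m _ do under eq_bigr => n _ do rewrite !torsion_frameE // pE.
under eq_bigr => m _ do rewrite -mulr_sumr !big_split /= -!mulr_sumr sum_delta6.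
rewrite -mulr_sumr !big_split /= -!mulr_sumr sum_delta6 sconst_norm.
by rewrite !sconst_contract; ring.
Qed.

Lemma curv_sq_bismut (R : realType) (t : R) (t0 : t != 0) (i j : 'I_6) x :
  curv_sq (structure_t t)
    (curv_form (structure_t t) (bismut (structure_t t))) i j x
  = 64 * t ^+ 4 * base_delta R i j.
Proof.
rewrite /curv_sq.
have -> : 64 * t ^+ 4 * base_delta R i j
    = \sum_m (16 * t ^+ 4) * (sconst R i m * sconst R j m).
  by rewrite -mulr_sumr sconst_contract; ring.
apply: eq_bigr => m _.
have curvE := curv_form_bismut t0.
have sE k : df6 (frame (structure_t t) k x) (frame (structure_t t) m x) = sconst R k m.
  by rewrite /= df6_frame df6_dual_frame.
under eq_bigr => a _ do under eq_bigr => b _ do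
  rewrite !curvE !sE.
have -> : 16 * t ^+ 4 * (sconst R i m * sconst R j m)
   = \sum_a \sum_b (t ^+ 4 * (sconst R i m * sconst R j m))
       * (sconst R a b * sconst R a b).
  under eq_bigr => a _ do rewrite -mulr_sumr sconst_contract.
  rewrite -mulr_sumr big_ord6 /base_delta /=; ring.
by apply: eq_bigr => a _; apply: eq_bigr => b _; ring.
Qed.

(** * Anti-self-dual forms on the base *)

(** The general anti-self-dual form on the base; equivalently, the general
    primitive form of type (1,1) in dz_1 and dz_2. *)
Definition asd_form (R : realType) (a b c : R) (u v : 'rV[R]_6) : R :=
  let w i j := coord u i * coord v j - coord u j * coord v i in
  2 * a * (w i1 i2 - w i3 i4) + 2 * b * (w i1 i3 + w i2 i4)
  - 2 * c * (w i2 i3 - w i1 i4).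

Lemma wedge22_asd (R : realType) (w : form2 R) (a b c : R) x u0 u1 u2 u3 :
  (forall u v, w x u v = asd_form a b c u v) ->
  wedge22 w w x u0 u1 u2 u3 = - 8 * (a ^+ 2 + b ^+ 2 + c ^+ 2) * vol4 u0 u1 u2 u3.
Proof.
move=> wE; rewrite /wedge22 !wE /asd_form /vol4 /=.
move: (coord u0) (coord u1) (coord u2) (coord u3) => v0 v1 v2 v3; ring.
Qed.

(** An anti-self-dual 4 x 4 matrix is a multiple of an isometry. *)
Lemma asd_form_frame_sq (R : realType) (t : R) (a b c : R) x i j :
  \sum_m asd_form a b c (dual_frame t i x) (dual_frame t m x)
       * asd_form a b c (dual_frame t j x) (dual_frame t m x)
  = 4 * (a ^+ 2 + b ^+ 2 + c ^+ 2) * base_delta R i j.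
Proof.
under eq_bigr => m _ do rewrite /asd_form !coord_dual_frame //.
rewrite big_ord6 /base_delta /=.
by move: i j; apply: ord6P; apply: ord6P => /=; ring.
Qed.

Lemma asd_form_J (R : realType) (t : R) (t0 : t != 0) (a b c : R) x u v :
  asd_form a b c (cplx_t t x u) (cplx_t t x v) = asd_form a b c u v.
Proof.
rewrite /asd_form /= !coord_cplx // /cplx_coord /=.
rewrite !(@coord_coframe _ t x _ i1) // !(@coord_coframe _ t x _ i2) //.
rewrite !(@coord_coframe _ t x _ i3) // !(@coord_coframe _ t x _ i4) //.
ring.
Qed.

Lemma asd_form_trace (R : realType) (t : R) (t0 : t != 0) (a b c : R) x :
  \sum_k asd_form a b c (dual_frame t k x) (cplx_t t x (dual_frame t k x)) = 0.
Proof.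
have cJ l i : i != i6 -> coord (cplx_t t x (dual_frame t l x)) i
    = cplx_coord (fun j => (j == l)%:R) i.
  move=> i6n; rewrite coord_cplx //.
  by congr cplx_coord; apply/funext => j; rewrite coframe_dual.
under eq_bigr => k _ do rewrite /asd_form !cJ // !coord_dual_frame //.
rewrite big_ord6 /cplx_coord /=.
ring.
Qed.

(** The difference quotients in the two directions are equal. *)
Lemma derive_vertical (R : realType) (h : 'rV[R]_6 -> R) (x v : 'rV[R]_6) s :
  (forall y r, h (y + r *: delta_mx ord0 i6) = h y) ->
  'D_(v + s *: delta_mx ord0 i6) h x = 'D_v h x.
Proof.
move=> h6; rewrite /derive.
have -> : (fun r : R => r^-1 *: ((h \o shift x) (r *: (v + s *: delta_mx ord0 i6))
                               - h x))
    = fun r => r^-1 *: ((h \o shift x) (r *: v) - h x) => //.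
apply/funext => r /=; congr (_ *: (_ - _)).
by rewrite scalerDr scalerA addrAC h6.
Qed.

Lemma derive_dual_frame (R : realType) (t : R) (h : 'rV[R]_6 -> R) x (i : 'I_6) :
  (forall y r, h (y + r *: delta_mx ord0 i6) = h y) -> i != i6 ->
  'D_(dual_frame t i x) h x = 'D_(delta_mx ord0 i) h x.
Proof.
by move=> h6 /negPf i6n; rewrite /dual_frame i6n derive_vertical.
Qed.

(** The connection forms of nabla^+ are multiples of e^6 and the form [w] is
    annihilated by E_6, so every Christoffel term vanishes and the divergence
    is that of the flat base. The four equations are its four components. *)
Lemma bismut_divergence_asd (R : realType) (t : R) (t0 : t != 0)
    (w : form2 R) (a b c : 'rV[R]_6 -> R) (x : 'rV[R]_6) (j : 'I_6) :
  let D h i := 'D_(delta_mx ord0 i) h x in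
  (forall y u v, w y u v = asd_form (a y) (b y) (c y) u v) ->
  (forall h, h \in [:: a; b; c] -> forall v, derivable h x v) ->
  (forall h, h \in [:: a; b; c] ->
    forall y r, h (y + r *: delta_mx ord0 i6) = h y) ->
  D a i4 + D b i1 - D c i2 = 0 -> D a i3 - D c i1 - D b i2 = 0 ->
  D a i2 + D b i3 + D c i4 = 0 -> D a i1 + D c i3 - D b i4 = 0 ->
  \sum_i cov2 (bismut (structure_t t)) w (dual_frame t i) (dual_frame t i)
    (dual_frame t j) x = 0.
Proof.
move=> D wE dh h6 e1 e2 e3 e4.
have covE i : cov2 (bismut (structure_t t)) w (dual_frame t i) (dual_frame t i)
    (dual_frame t j) x = asd_form (D a i) (D b i) (D c i)
      (dual_frame t i x) (dual_frame t j x).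
  have wD : (fun y => w y (dual_frame t i y) (dual_frame t j y))
      = fun y => asd_form (a y) (b y) (c y) (delta_mx ord0 i) (delta_mx ord0 j).
    apply/funext => y; rewrite wE /asd_form !coord_dual_frame // /coord !mxE !eqxx /=.
    by rewrite ![_ == i]eq_sym ![_ == j]eq_sym.
  have flat : bismut (structure_t t) (dual_frame t i) (dual_frame t i) x = 0.
    rewrite (connection_forms_frame (connection_forms_bismut t0)) big1 // => k _.
    rewrite invariant_forms_frame // /bismut_coef.
    by have [->|_] := eqVneq i i6; rewrite ?sconst6l !(mulr0, mul0r, scale0r).
  have vert : w x (dual_frame t i x)
      (bismut (structure_t t) (dual_frame t i) (dual_frame t j) x) = 0.
    rewrite (connection_forms_frame (connection_forms_bismut t0)).
    have [->|i6n] := eqVneq i i6.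
      by rewrite wE /asd_form !coord_dual_frame //=; ring.
    rewrite big1 => [|k _].
      by rewrite wE /asd_form /coord !mxE; ring.
    rewrite invariant_forms_frame // /bismut_coef (negPf i6n).
    by rewrite mulr0 scale0r.
  rewrite /cov2 flat vert wD wE.
  have asd0 (v : 'rV[R]_6) : asd_form (a x) (b x) (c x) 0 v = 0.
    by rewrite /asd_form /coord !mxE; ring.
  rewrite asd0 !subr0; have [i6E|i6n] := eqVneq i i6.
    rewrite i6E (_ : (fun y => _) = cst 0) ?derive_cst; last first.
      by apply/funext => y; rewrite /asd_form /coord !mxE /=; ring.
    by rewrite /asd_form !coord_dual_frame //=; ring.
  have Dh h : h \in [:: a; b; c] -> is_derive x (dual_frame t i x) h (D h i).
    move=> hin; apply: DeriveDef; first exact: dh.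
    by rewrite derive_dual_frame //; exact: h6.
  have [Da Db Dc] : [/\ is_derive x (dual_frame t i x) a (D a i),
      is_derive x (dual_frame t i x) b (D b i) &
      is_derive x (dual_frame t i x) c (D c i)].
    by split; apply: Dh; rewrite !inE eqxx ?orbT.
  pose W k l : R := (k == i)%:R * (l == j)%:R - (l == i)%:R * (k == j)%:R.
  rewrite (_ : (fun y => _) = (2 * (W i1 i2 - W i3 i4)) *: a
      + (2 * (W i1 i3 + W i2 i4)) *: b - (2 * (W i2 i3 - W i1 i4)) *: c); last first.
    apply/funext => y; rewrite !fctE /asd_form /coord !mxE !eqxx /= /GRing.scale /=.
    by rewrite /W; ring.
  have := is_deriveB (is_deriveD
    (is_deriveZ (2 * (W i1 i2 - W i3 i4)) Da)
    (is_deriveZ (2 * (W i1 i3 + W i2 i4)) Db))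
    (is_deriveZ (2 * (W i2 i3 - W i1 i4)) Dc).
  move=> /@derive_val ->; rewrite /asd_form !coord_dual_frame // /GRing.scale /=.
  by rewrite /W; ring.
under eq_bigr => i _ do rewrite covE /asd_form !coord_dual_frame //.
move: (D a) (D b) (D c) e1 e2 e3 e4 => Da Db Dc e1 e2 e3 e4.
by rewrite big_ord6 /=; move: j {covE}; apply: ord6P => /=; lra.
Qed.

(** * The abelian instanton *)

Lemma inst_coef_parts (R : realType) (f g : R) :
  complex.Re (inst_coef f g) = cos g * Num.sqrt (4^-1 - f ^+ 2) /\
  complex.Im (inst_coef f g) = sin g * Num.sqrt (4^-1 - f ^+ 2).
Proof. by rewrite /inst_coef /expi /=; split; ring. Qed.

(** The real and imaginary parts of the mixed coefficient of the curvature. *)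
Definition inst_re (R : realType) (f gamma : R[i] -> R[i] -> R) x :=
  cos (gamma (z1 x) (z2 x)) * Num.sqrt (4^-1 - f (z1 x) (z2 x) ^+ 2).
Definition inst_im (R : realType) (f gamma : R[i] -> R[i] -> R) x :=
  sin (gamma (z1 x) (z2 x)) * Num.sqrt (4^-1 - f (z1 x) (z2 x) ^+ 2).
Definition inst_diag (R : realType) (f : R[i] -> R[i] -> R) (x : 'rV[R]_6) :=
  f (z1 x) (z2 x).

Lemma instanton_curvature (R : realType) (L : set 'rV[R]_6)
    (A : u1_connection L) (f gamma : R[i] -> R[i] -> R) :
  abelian_instanton A f gamma -> forall x u v,
  u1_curvature A x u v
  = asd_form (inst_diag f x) (inst_re f gamma x) (inst_im f gamma x) u v.
Proof.
move=> [_ + _ _] x u v => /(_ x u v) /(congr1 (@complex.Re R)) /= ->.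
rewrite /asd_form /inst_diag /inst_re /inst_im cosN sinN /coframe_f /=.
ring.
Qed.

Lemma instanton_norm (R : realType) (L : set 'rV[R]_6)
    (A : u1_connection L) (f gamma : R[i] -> R[i] -> R) x :
  abelian_instanton A f gamma ->
  inst_diag f x ^+ 2 + inst_re f gamma x ^+ 2 + inst_im f gamma x ^+ 2 = 4^-1.
Proof.
move=> [/(_ x) /= fle _ _ _]; rewrite /inst_re /inst_im !exprMn sqr_sqrtr.
  have := cos2Dsin2 (gamma (z1 x) (z2 x)); rewrite /inst_diag.
  move: (cos _ ^+ 2) (sin _ ^+ 2) (f _ _ ^+ 2) => C S F e.
  by rewrite -addrA -mulrDl e mul1r addrC subrK.
rewrite subr_ge0 -[_ ^+ 2]real_normK ?num_real //.
rewrite (_ : 4^-1 = 2^-1 ^+ 2); last by field.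
by rewrite ler_sqr ?nnegrE // invr_ge0.
Qed.

Lemma derivable_u1_curvature (R : realType) (L : set 'rV[R]_6)
    (A : u1_connection L) (u v x w : 'rV[R]_6) :
  derivable (fun y => u1_curvature A y u v) x w.
Proof.
apply: diff_derivable; apply: differentiableB.
  exact: (pot_smooth A v [:: u] x).
exact: (pot_smooth A u [:: v] x).
Qed.

(** The coefficients are halves of values of the curvature on constant fields,
    hence as differentiable as the curvature, although gamma need not even be
    continuous. *)
Lemma instanton_derivable (R : realType) (L : set 'rV[R]_6)
    (A : u1_connection L) (f gamma : R[i] -> R[i] -> R) x w :
  abelian_instanton A f gamma ->
  [/\ derivable (inst_diag f) x w, derivable (inst_re f gamma) x w &
      derivable (inst_im f gamma) x w].
Proof.
move=> /instanton_curvature cA.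
have D (h : 'rV[R]_6 -> R) i j : (forall y, h y
    = 2^-1 * u1_curvature A y (delta_mx ord0 i) (delta_mx ord0 j)) ->
    derivable h x w.
  move=> hE; rewrite (_ : h = 2^-1 *: (fun y => u1_curvature A y
    (delta_mx ord0 i) (delta_mx ord0 j))); last by apply/funext.
  by apply: derivableZ; exact: derivable_u1_curvature.
split; [apply: (D _ i1 i2)|apply: (D _ i1 i3)|apply: (D _ i1 i4)] => y;
  by rewrite cA /asd_form /coord !mxE /=; field.
Qed.

(** The real and imaginary parts of the two complex equations. *)
Lemma instanton_equations (R : realType) (L : set 'rV[R]_6)
    (A : u1_connection L) (f gamma : R[i] -> R[i] -> R) x :
  abelian_instanton A f gamma ->
  let D h i := 'D_(delta_mx ord0 i) h x in
  let a := inst_diag f in let b := inst_re f gamma in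
  let c := inst_im f gamma in
  [/\ D a i4 + D b i1 - D c i2 = 0, D a i3 - D c i1 - D b i2 = 0,
      D a i2 + D b i3 + D c i4 = 0 & D a i1 + D c i3 - D b i4 = 0].
Proof.
move=> instA D a b c.
have Dc w : derivable c x w by case: (instanton_derivable x w instA).
case: instA => _ _ /(_ x) E1 /(_ x) E2.
have reP : (fun y => complex.Re (inst_coef (f (z1 y) (z2 y))
    (gamma (z1 y) (z2 y)))) = b.
  by apply/funext => y; rewrite (inst_coef_parts _ _).1.
have imP : (fun y => complex.Im (inst_coef (f (z1 y) (z2 y))
    (gamma (z1 y) (z2 y)))) = c.
  by apply/funext => y; rewrite (inst_coef_parts _ _).2.
have reN : (fun y => complex.Re (inst_coef (f (z1 y) (z2 y))
    (- gamma (z1 y) (z2 y)))) = b.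
  by apply/funext => y; rewrite (inst_coef_parts _ _).1 cosN.
have imN : (fun y => complex.Im (inst_coef (f (z1 y) (z2 y))
    (- gamma (z1 y) (z2 y)))) = - c.
  by apply/funext => y; rewrite (inst_coef_parts _ _).2 sinN mulNr.
move: E1 E2; rewrite /d_z1 /d_z2 /cderive reP imP reN imN !deriveN //.
rewrite (_ : (fun y => complex.Re (Complex (f (z1 y) (z2 y)) 0)) = a) //.
rewrite (_ : (fun y => complex.Im (Complex (f (z1 y) (z2 y)) 0)) = cst 0) //.
rewrite !derive_cst.
rewrite -!/(D _ _).
have half (X Y : R[i]) : Complex 0 1 * (2^-1 * X) + 2^-1 * Y = 0 ->
    Complex 0 1 * X + Y = 0.
  rewrite mulrCA -mulrDr => /eqP; rewrite mulf_eq0 invr_eq0 pnatr_eq0 /=.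
  by move/eqP.
move: (D a) (D b) (D c) => Da Db Dc' /half E1 /half E2.
have [/= r1 m1] := (congr1 (@complex.Re R) E1, congr1 (@complex.Im R) E1).
have [/= r2 m2] := (congr1 (@complex.Re R) E2, congr1 (@complex.Im R) E2).
by split; lra.
Qed.

Lemma instanton_vertical (R : realType) (f gamma : R[i] -> R[i] -> R)
    (y : 'rV[R]_6) r : let y' := y + r *: delta_mx ord0 i6 in
  [/\ inst_diag f y' = inst_diag f y, inst_re f gamma y' = inst_re f gamma y &
      inst_im f gamma y' = inst_im f gamma y].
Proof.
move=> y'; have c i : i != i6 -> coord y' i = coord y i.
  by rewrite /coord !mxE eqxx /= => /negPf ->; rewrite mulr0 addr0.
by rewrite /inst_diag /inst_re /inst_im /z1 /z2 !c.
Qed.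

(** A single formula for the three cases, linear in the curvature of [A]. *)
Lemma so2_curvatureE (R : realType) (L : set 'rV[R]_6) (A : u1_connection L)
    (a b : 'I_2) :
  so2_curvature A a b
  = fun x u v => ((a < b)%N%:R - (b < a)%N%:R) * u1_curvature A x u v.
Proof.
apply/funext => x; apply/funext => u; apply/funext => v.
rewrite /so2_curvature; case: ltngtP => _; rewrite /=; ring.
Qed.

Lemma so2_curvature_antisym (R : realType) (L : set 'rV[R]_6)
    (A : u1_connection L) (a b : 'I_2) x u v :
  so2_curvature A b a x u v = - so2_curvature A a b x u v.
Proof. by rewrite !so2_curvatureE; ring. Qed.

Lemma pontrjagin_instanton (R : realType) (L : set 'rV[R]_6)
    (A : u1_connection L) (f gamma : R[i] -> R[i] -> R)
    (instA : abelian_instanton A f gamma) x u0 u1 u2 u3 :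
  pontrjagin (so2_curvature A) x u0 u1 u2 u3
  = (8 * pi ^+ 2)^-1 * (- 2 * vol4 u0 u1 u2 u3).
Proof.
rewrite /pontrjagin; congr (_ * _).
under eq_bigr do rewrite big_mkcond.
rewrite !big_ord_recl !big_ord0 /= !addr0 add0r.
rewrite (@wedge22_asd _ _ (inst_diag f x) (inst_re f gamma x) (inst_im f gamma x)).
  by rewrite (instanton_norm x instA); field.
by move=> u v; rewrite so2_curvatureE /= subr0 mul1r (instanton_curvature instA).
Qed.

Lemma instanton_su3 (R : realType) (L : set 'rV[R]_6)
    (A : u1_connection L) (f gamma : R[i] -> R[i] -> R)
    (instA : abelian_instanton A f gamma) (t : R) (t0 : t != 0) :
  su3_instanton (structure_t t) (so2_curvature A).
Proof.
move=> a b x; split=> [u v|] /=.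
  by rewrite !so2_curvatureE !(instanton_curvature instA) asd_form_J.
under eq_bigr => k _ do rewrite so2_curvatureE (instanton_curvature instA).
by rewrite -mulr_sumr asd_form_trace // mulr0.
Qed.

Lemma instanton_curv_sq (R : realType) (L : set 'rV[R]_6)
    (A : u1_connection L) (f gamma : R[i] -> R[i] -> R)
    (instA : abelian_instanton A f gamma) (t : R) (t0 : t != 0) i j x :
  curv_sq (structure_t t) (so2_curvature A) i j x = 2 * base_delta R i j.
Proof.
have sq : \sum_m u1_curvature A x (dual_frame t i x) (dual_frame t m x)
    * u1_curvature A x (dual_frame t j x) (dual_frame t m x) = base_delta R i j.
  under eq_bigr => m _ do rewrite !(instanton_curvature instA).
  by rewrite asd_form_frame_sq (instanton_norm x instA) divff ?mul1r // pnatr_eq0.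
rewrite -sq mulr_sumr /curv_sq; apply: eq_bigr => m _.
rewrite !big_ord_recl !big_ord0 !so2_curvatureE /=; ring.
Qed.

(** [so2_curvature] is a constant multiple of the curvature of [A], to which
    [bismut_divergence_asd] applies. *)
Lemma instanton_yang_mills (R : realType) (L : set 'rV[R]_6)
    (A : u1_connection L) (f gamma : R[i] -> R[i] -> R)
    (instA : abelian_instanton A f gamma) (t : R) (t0 : t != 0) a b j x :
  \sum_i cov2 (bismut (structure_t t)) (so2_curvature A a b) (dual_frame t i)
    (dual_frame t i) (dual_frame t j) x = 0.
Proof.
have YM : \sum_i cov2 (bismut (structure_t t)) (u1_curvature A) (dual_frame t i)
    (dual_frame t i) (dual_frame t j) x = 0.
  have [e1 e2 e3 e4] := instanton_equations x instA.
  apply: (bismut_divergence_asd t0 _ _ _ _ e1 e2 e3 e4).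
  - exact: instanton_curvature.
  - move=> h hin v; have [da db dc] := instanton_derivable x v instA.
    by move: hin; rewrite !inE => /or3P[] /eqP ->.
  - move=> h hin y r; have [va vb vc] := instanton_vertical f gamma y r.
    by move: hin; rewrite !inE => /or3P[] /eqP ->.
rewrite so2_curvatureE; set s := (_ - _ : R).
have := congr1 ( *%R s) YM; rewrite mulr0; apply: etrans.
rewrite mulr_sumr; apply: eq_bigr => i _.
rewrite /cov2 !mulrBr; congr (_ - _ - _).
have E : (fun y => u1_curvature A y (dual_frame t i y) (dual_frame t j y))
    = fun y => u1_curvature A y (delta_mx ord0 i) (delta_mx ord0 j).
  apply/funext => y; rewrite !(instanton_curvature instA).
  rewrite /asd_form !coord_dual_frame // /coord !mxE !eqxx /=.
  by rewrite ![_ == i]eq_sym ![_ == j]eq_sym.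
have D : derivable (fun y => u1_curvature A y (delta_mx ord0 i)
  (delta_mx ord0 j)) x (dual_frame t i x) by exact: derivable_u1_curvature.
by rewrite E -[RHS](deriveZ s D) -E.
Qed.

(** * Compactness of the nilmanifold *)

Definition join_coord (R : realType) (y : 'rV[R]_5) (r : R) : 'rV[R]_6 :=
  \row_i (if unlift i5 i is Some j then y ord0 j else r).

Lemma heis_part_join (R : realType) (y : 'rV[R]_5) r :
  heis_part (join_coord y r) = y.
Proof. by apply/rowP => i; rewrite !mxE liftK. Qed.

Lemma coord_join (R : realType) (y : 'rV[R]_5) r :
  coord (join_coord y r) i5 = r.
Proof. by rewrite /coord mxE unlift_none. Qed.

Lemma row6_split_inj (R : realType) (x y : 'rV[R]_6) :
  heis_part x = heis_part y -> coord x i5 = coord y i5 -> x = y.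
Proof.
move=> /rowP hxy h5; apply/rowP => i.
case: (unliftP i5 i) => [j ->|->]; last exact: h5.
by have := hxy j; rewrite !mxE.
Qed.

Lemma join_coord_continuous (R : realType) :
  continuous (fun p : 'rV[R]_5 * R => join_coord p.1 p.2).
Proof.
move=> p; apply/cvg_mx_entourageP => A entA.
apply: filter_forall => i; apply: filter_forall => j.
suff /cvg_app_entourageP/(_ _ entA) : 
    join_coord q.1 q.2 i j @[q --> p] --> join_coord p.1 p.2 i j.
  by apply: filterS => q ?; exact: mem_set.
rewrite (_ : (fun q => _) = fun q : 'rV[R]_5 * R =>
    if unlift i5 j is Some k then q.1 ord0 k else q.2); last first.
  by apply/funext => q; rewrite mxE.
rewrite mxE; case: (unlift i5 j) => [k|]; last exact: cvg_snd.
apply: (@continuous_comp _ _ _ fst (fun y : 'rV[R]_5 => y ord0 k)).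
  exact: cvg_fst.
exact: coord_continuous.
Qed.

(** The lattice brings the Heisenberg component into K; the circle component
    is brought into [0, ell] by subtracting a multiple of ell. *)
Lemma deck_fundamental_domain (R : realType) (Gam : heis_lattice R) (ell : R)
    (ell_gt0 : 0 < ell) (K : set 'rV[R]_5) (y : 'rV[R]_6) :
  (forall y, exists a k, [/\ lat Gam a, K k & y = heis_mul a k]) ->
  exists k r, [/\ K k, `[0, ell]%classic r & deck_rel Gam ell (join_coord k r) y].
Proof.
move=> /(_ (heis_part y))[a [k [lata Kk yE]]].
pose n := Num.floor (coord y i5 / ell); pose r := coord y i5 - ell * n%:~R.
exists k, r; split => //.
  rewrite /= in_itv /= /r; have := ge_floor (coord y i5 / ell).
  have := lt_succ_floor (coord y i5 / ell); rewrite -/n intrD.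
  rewrite ltr_pdivrMr // ler_pdivlMr // mulrDl mul1r mulrC => lt le.
  by apply/andP; split; lra.
apply/asboolP; exists (join_coord a (ell * n%:~R)).
  by split; [rewrite heis_part_join|exists n; rewrite coord_join].
apply: row6_split_inj; first by rewrite heis_partM !heis_part_join.
have gM (p q : 'rV[R]_6) : coord (grp_mul p q) i5 = coord p i5 + coord q i5.
  by rewrite /grp_mul /coord !mxE /=; ring.
by rewrite gM !coord_join /r; ring.
Qed.

Lemma M3_compact (R : realType) (Gam : heis_lattice R) (ell : R)
    (ell_gt0 : 0 < ell) : compact [set: M3 Gam ell].
Proof.
have [K cK KP] := lat_cocompact Gam.
pose f (p : 'rV[R]_5 * R) : M3 Gam ell :=
  (\pi_(M3 Gam ell) (join_coord p.1 p.2))%qT.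
have cf : continuous f.
  move=> p; apply: continuous_comp; first exact: join_coord_continuous.
  exact: pi_continuous.
rewrite (_ : [set: _] = f @` (K `*` `[0, ell]%classic)).
  apply: continuous_compact; first exact: continuous_subspaceT.
  apply: compact_setX => //; exact: segment_compact.
apply/seteqP; split => // q _.
have [k [r [Kk r_ell kr]]] := deck_fundamental_domain ell_gt0 (repr q) KP.
by exists (k, r) => //; rewrite /f /= -[RHS]reprK; apply/eqquotP.
Qed.

(** * The heterotic system *)

Lemma trace_sq_lc (R : realType) (t : R) (t0 : t != 0) x u0 u1 u2 u3 :
  trace_sq (curv_form (structure_t t) (levi_civita (structure_t t))) x u0 u1 u2 u3
  = - 48 * t ^+ 4 * vol4 u0 u1 u2 u3.
Proof.
rewrite trace_sq_pontrjagin ?pontrjagin_lc //; last first.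
  by move=> i j u v; rewrite !curv_form_lc // /lc_curv (sconst_antisym R i j); ring.
have := pi_neq0 R.
by move: pi => p p0; field; exact: p0.
Qed.

Lemma trace_sq_bismut (R : realType) (t : R) (t0 : t != 0) x u0 u1 u2 u3 :
  trace_sq (curv_form (structure_t t) (bismut (structure_t t))) x u0 u1 u2 u3
  = - 128 * t ^+ 4 * vol4 u0 u1 u2 u3.
Proof.
rewrite trace_sq_pontrjagin ?pontrjagin_bismut //; last first.
  by move=> i j u v; rewrite !curv_form_bismut // (sconst_antisym R i j); ring.
have := pi_neq0 R.
by move: pi => p p0; field; exact: p0.
Qed.

Lemma trace_sq_instanton (R : realType) (L : set 'rV[R]_6)
    (A : u1_connection L) (f gamma : R[i] -> R[i] -> R)
    (instA : abelian_instanton A f gamma) x u0 u1 u2 u3 :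
  trace_sq (so2_curvature A) x u0 u1 u2 u3 = - 4 * vol4 u0 u1 u2 u3.
Proof.
rewrite trace_sq_pontrjagin ?(pontrjagin_instanton instA) //; last first.
  by move=> i j u v; exact: so2_curvature_antisym.
have := pi_neq0 R.
by move: pi => p p0; field; exact: p0.
Qed.

Lemma vol4_basis (R : realType) :
  vol4 (delta_mx ord0 i1) (delta_mx ord0 i2) (delta_mx ord0 i3)
    (delta_mx ord0 i4) = 1 :> R.
Proof. by rewrite /vol4 /coord !mxE /=; ring. Qed.

Lemma nonzero_flux_t (R : realType) (t : R) (t0 : t != 0) :
  nonzero_flux (structure_t t).
Proof.
exists 0, (dual_frame t i6 0), (dual_frame t i1 0), (dual_frame t i2 0).
rewrite torsion_frameE // /torsion_coef !sconstE /=.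
rewrite (_ : t * _ = - 2 * t); last by ring.
by rewrite mulf_neq0 // oppr_eq0 pnatr_eq0.
Qed.

(** Both sides of the Bianchi identity are multiples of f^1234, so the
    identity amounts to one equation on alpha', read off on the coordinate
    vectors. *)
Lemma bianchi_bismutP (R : realType) (L : set 'rV[R]_6)
    (A : u1_connection L) (f gamma : R[i] -> R[i] -> R)
    (instA : abelian_instanton A f gamma) (t : R) (t0 : t != 0) (alpha : R) :
  bianchi (structure_t t) (bismut (structure_t t)) (so2_curvature A) alpha
  <-> alpha * (32 * t ^+ 4 - 1) = 8 * t ^+ 2.
Proof.
split=> [B|aE x u0 u1 u2 u3].
  have := B 0 (delta_mx ord0 i1) (delta_mx ord0 i2) (delta_mx ord0 i3)
    (delta_mx ord0 i4).
  rewrite d3_torsion // trace_sq_bismut // (trace_sq_instanton instA) vol4_basis.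
  by move: (t ^+ 2) (t ^+ 4) => p q; lra.
rewrite d3_torsion // trace_sq_bismut // (trace_sq_instanton instA).
rewrite (_ : - 8 * t ^+ 2 = - (alpha * (32 * t ^+ 4 - 1))); first by field.
by rewrite aE; ring.
Qed.

Lemma bianchi_levi_civita (R : realType) (L : set 'rV[R]_6)
    (A : u1_connection L) (f gamma : R[i] -> R[i] -> R)
    (instA : abelian_instanton A f gamma) (t : R) (t0 : t != 0) (alpha : R) :
  alpha * (12 * t ^+ 4 - 1) = 8 * t ^+ 2 ->
  bianchi (structure_t t) (levi_civita (structure_t t)) (so2_curvature A) alpha.
Proof.
move=> aE x u0 u1 u2 u3; rewrite d3_torsion // trace_sq_lc //.
rewrite (trace_sq_instanton instA).
rewrite (_ : - 8 * t ^+ 2 = - (alpha * (12 * t ^+ 4 - 1))); first by field.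
by rewrite aE; ring.
Qed.

(** The Einstein equation is a multiple of the metric of the base; its
    coefficient vanishes by the hypothesis on alpha'. *)
Lemma heterotic_eom_t (R : realType) (L : set 'rV[R]_6)
    (A : u1_connection L) (f gamma : R[i] -> R[i] -> R)
    (instA : abelian_instanton A f gamma) (t : R) (t0 : t != 0) (alpha : R) :
  alpha * (32 * t ^+ 4 - 1) = 8 * t ^+ 2 ->
  heterotic_eom (structure_t t) (bismut (structure_t t)) (so2_curvature A) alpha.
Proof.
move=> aE; split=> [i j x|j k x|a b j x].
- rewrite ricci_t // flux_sq_t // (instanton_curv_sq instA) // curv_sq_bismut //.
  rewrite (_ : alpha / 4 * _ = - (alpha * (32 * t ^+ 4 - 1)) / 2 * base_delta R i j).
    by rewrite aE; field.
  by field.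
- exact: torsion_coclosed.
- exact: (instanton_yang_mills instA).
Qed.

Theorem theorem5p2 (R : realType) (Gam : heis_lattice R) (ell : R)
    (ell_gt0 : 0 < ell) (A : u1_connection (deck Gam ell))
    (f gamma : R[i] -> R[i] -> R) (instA : abelian_instanton A f gamma)
    (t : R) (t_neq0 : t != 0) :
  let S := structure_t t in
  let OmA := so2_curvature A in
  [/\ 12 * t ^+ 4 != 1 -> forall x u0 u1 u2 u3,
        d3 (torsion S) x u0 u1 u2 u3
        = 32 * pi ^+ 2 * t ^+ 2 / (12 * t ^+ 4 - 1)
          * (pontrjagin (curv_form S (levi_civita S)) x u0 u1 u2 u3
             - pontrjagin OmA x u0 u1 u2 u3),
      32 * t ^+ 4 != 1 -> forall x u0 u1 u2 u3,
        d3 (torsion S) x u0 u1 u2 u3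
        = 32 * pi ^+ 2 * t ^+ 2 / (32 * t ^+ 4 - 1)
          * (pontrjagin (curv_form S (bismut S)) x u0 u1 u2 u3
             - pontrjagin OmA x u0 u1 u2 u3),
      1 < 12 * t ^+ 4 ->
        [/\ heterotic_susy S OmA, nonzero_flux S,
            exists2 alpha, 0 < alpha & bianchi S (levi_civita S) OmA alpha &
            exists2 alpha, 0 < alpha & bianchi S (bismut S) OmA alpha] &
      32 * t ^+ 4 != 1 ->
        [/\ compact [set: M3 Gam ell],
            exists alpha, bianchi S (bismut S) OmA alpha &
            forall alpha, bianchi S (bismut S) OmA alpha ->
              heterotic_eom S (bismut S) OmA alpha]].
Proof.
move=> S OmA.
have pi0 := pi_neq0 R.
have alphaE c : c * t ^+ 4 - 1 != 0 ->
    8 * t ^+ 2 / (c * t ^+ 4 - 1) * (c * t ^+ 4 - 1) = 8 * t ^+ 2.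
  by move=> c0; rewrite divfK.
have alpha_gt0 c : 0 < c * t ^+ 4 - 1 -> 0 < 8 * t ^+ 2 / (c * t ^+ 4 - 1).
  by move=> c0; rewrite divr_gt0 // mulr_gt0 // exprn_even_gt0.
split.
- rewrite -subr_eq0 => t12 x u0 u1 u2 u3.
  rewrite d3_torsion // pontrjagin_lc // (pontrjagin_instanton instA).
  by move: pi pi0 => p p0; field; rewrite t12 p0.
- rewrite -subr_eq0 => t32 x u0 u1 u2 u3.
  rewrite d3_torsion // pontrjagin_bismut // (pontrjagin_instanton instA).
  by move: pi pi0 => p p0; field; rewrite t32 p0.
- move=> t12; have t12' : 0 < 12 * t ^+ 4 - 1 by rewrite subr_gt0.
  have t32' : 0 < 32 * t ^+ 4 - 1 by move: t12; move: (t ^+ 4) => q; lra.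
  split.
  + split; [exact: hermitian_t|exact: su3_holonomy_t|exact: balanced_t|].
    exact: (instanton_su3 instA).
  + exact: nonzero_flux_t.
  + exists (8 * t ^+ 2 / (12 * t ^+ 4 - 1)); first exact: alpha_gt0.
    by apply: (bianchi_levi_civita instA) => //; apply: alphaE; rewrite lt0r_neq0.
  + exists (8 * t ^+ 2 / (32 * t ^+ 4 - 1)); first exact: alpha_gt0.
    by apply/(bianchi_bismutP instA) => //; apply: alphaE; rewrite lt0r_neq0.
- rewrite -subr_eq0 => t32; split; first exact: M3_compact.
  + exists (8 * t ^+ 2 / (32 * t ^+ 4 - 1)).
    by apply/(bianchi_bismutP instA) => //; exact: alphaE.
  + by move=> alpha /(bianchi_bismutP instA t_neq0)/(heterotic_eom_t instA); apply.
Qed.
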